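(* Let $c\ge 1$ be an integer and define \[\min\nolimits^1_f(c)=\begin{cases} 6 & \text{if } c=1,\\ 9 & \text{if } c\in\{2,3\},\\ 10 & \text{if } c\in\{4,5\},\\ 12 & \text{if } c=6,\\ 14 & \text{if } c=7,\\ 15 & \text{if } c\ge 8.\end{cases}\] (i) There exist $c$-connected maps having exactly one face of size $\min^1_f(c)$ and all other faces triangles, whose dual is simple and has a $1$-cut (cut-vertex). (ii) If $G$ is a $c$-connected map with a simple dual $G^*$ and every face of $G$ has size smaller than $\min^1_f(c)$, then $G^*$ is $2$-connected.
   Context: A map is a simple connected graph together with a cellular embedding in a closed orientable surface; the size of a face is the length of its facial walk. The dual $G^*$ of a map $G$ has the faces of $G$ as vertices, with one edge for each edge of $G$ joining the faces on its two sides; ''simple dual'' means $G^*$ has no loops and no multiple edges. A $1$-cut is a single vertex whose removal disconnects the graph. *)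

(* Defs.v *)
From mathcomp Require Import all_boot all_fingroup.
Set Implicit Arguments. Unset Strict Implicit. Unset Printing Implicit Defensive.

(* A finite graph is given by a set A of vertices in a finType and an adjacency
   relation e; only the edges of e with both ends in A count. *)
Section Connectivity.
Variables (T : finType) (e : rel T).

Definition connected_on (A : {set T}) : Prop :=
  {in A &, forall x y, connect [rel u v | [&& u \in A, v \in A & e u v]] x y}.

(* In particular the complete graph on n.+1 vertices is n-connected but not
   n.+1-connected, and the one-vertex graph is not 1-connected. *)
Definition k_connected (k : nat) (A : {set T}) : Prop :=
  k < #|A| /\
  forall S : {set T}, S \subset A -> #|S| < k -> connected_on (A :\: S).

Definition has_1cut (A : {set T}) : Prop :=
  exists2 x, x \in A & ~ connected_on (A :\ x).

End Connectivity.

(* Cellular embeddings of a connected simple graph in closed oriented surfaces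
   are encoded, as usual, by rotation systems: each vertex v carries a cyclic
   permutation of its neighbours, namely their cyclic order around v.
   The permutation rot v is the identity away from the neighbours of v. *)
Record emap := EMap {
  vertex : finType;
  adj : rel vertex;
  adj_sym : symmetric adj;
  adj_irr : irreflexive adj;
  vertex_gt0 : 0 < #|vertex|;
  adj_connected : connected_on adj [set: vertex];
  rot : vertex -> {perm vertex};
  rot_on : forall v, perm_on [set u | adj v u] (rot v);
  rot_cyclic : forall v u, adj v u -> porbit (rot v) u = [set w | adj v w]
}.

Section Faces.
Variable G : emap.

(* The dart (u, v) is the edge uv traversed from u to v. *)
Definition darts : {set vertex G * vertex G} := [set d | adj d.1 d.2].

Definition edges : {set {set vertex G}} := [set [set d.1; d.2] | d in darts].

(* Arriving at v from u, a facial walk leaves v along the successor of u in the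
   rotation at v. *)
Definition face_step (d : vertex G * vertex G) := (d.2, rot d.2 d.1).

Lemma face_step_inj : injective face_step.
Proof. by case=> u v [u' v'] [/= ->] /perm_inj ->. Qed.

(* A face is identified with the set of darts of its facial walk. A facial walk
   uses each dart at most once (but may use an edge in both directions), so the
   size of a face is the cardinal of this set. The only map with a face not
   captured in this way is the single vertex on the sphere, which has no
   darts and is not 1-connected. *)
Definition face (d : vertex G * vertex G) : {set vertex G * vertex G} :=
  [set d' | fconnect face_step d d'].

Definition faces : {set {set vertex G * vertex G}} := [set face d | d in darts].

(* The dual multigraph has vertex set faces and edge set edges; the edge E of G,
   seen as a dual edge, has the following set of ends, which is a singleton
   exactly when the dual edge is a loop. *)
Definition dual_ends (E : {set vertex G}) : {set {set vertex G * vertex G}} :=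
  [set face d | d in darts & [set d.1; d.2] == E].

Definition dual_adj : rel {set vertex G * vertex G} :=
  [rel F F' | [exists E in edges, dual_ends E == [set F; F']]].

Definition simple_dual : Prop :=
  (forall E, E \in edges -> #|dual_ends E| = 2) /\ {in edges &, injective dual_ends}.

End Faces.

(* Meaningful for c >= 1 only. *)
Definition min1f (c : nat) : nat :=
  match c with
  | 1 => 6
  | 2 | 3 => 9
  | 4 | 5 => 10
  | 6 => 12
  | 7 => 14
  | _ => 15
  end.

(* Main.v *)
Require Import Defs.
From mathcomp Require Import all_boot all_fingroup ssralg zmodp zify ring.
Set Implicit Arguments. Unset Strict Implicit. Unset Printing Implicit Defensive.
Import GRing.Theory.

(* If a face F is a cut-vertex of the dual, the other faces split into two
   classes A and B without common edges.  The edges of F facing A form a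
   circulation without opposite darts, and so do those facing B.  A vertex
   shared by both sides lies on both circulations, and unless all vertices of
   one side are shared, the shared vertices form a cut of the map.  With k
   shared vertices, |F| >= 2k, and since at most k(k-1)/2 edges of F join shared
   vertices, also 2|F| >= 8k - k(k-1); for k = 2 the order in which F traverses
   the circulations matters.  If all n vertices of the side A are shared, count
   edges instead: each edge of F facing A uses its own triangle of A, so A has
   at least 4|F_A| darts, which compete with the edges of F facing B for the
   n(n-1) available darts.  This gives |F| >= 14, with equality only for n = 7;
   then "apex of the triangle on the outgoing boundary edge" is a fixed-point
   free involution of seven vertices.

   Conversely, the extremal maps for c < 8 are small and explicit.  For c >= 8
   take the triangular embedding of K_{n,n,n} given by the Cayley table of Z/n
   and glue an annulus of six triangles (an octahedron without two opposite
   faces) into six vertices of one class. *)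

(* [rot] is also a function on sequences. *)
Local Notation rot := Defs.rot.

(** * Darts and circulations *)

Section Darts.
Variable G : emap.
Local Notation dart := (vertex G * vertex G)%type.
Implicit Types (d : dart) (S E : {set dart}) (v : vertex G) (X : {set vertex G}).

Definition opp d : dart := (d.2, d.1).

Lemma oppK : involutive opp.
Proof. by case. Qed.

Lemma opp_inj : injective opp.
Proof. exact: inv_inj oppK. Qed.

Lemma opp_dart d : (opp d \in darts G) = (d \in darts G).
Proof. by rewrite !inE adj_sym. Qed.

Lemma dart_neq d : d \in darts G -> d.1 != d.2.
Proof. by rewrite inE; case: eqP => // ->; rewrite adj_irr. Qed.

Lemma rot_adj v u : adj v u -> adj v (rot v u).
Proof.
move=> vu; have := mem_porbit (rot v) 1 u.
by rewrite (rot_cyclic vu) inE expg1.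
Qed.

Lemma step_dart d : d \in darts G -> face_step d \in darts G.
Proof. by rewrite !inE adj_sym => /rot_adj. Qed.

(** The neighbours of [v] form a single cycle of [rot v], so a property preserved along the rotation
    spreads from one neighbour to all. All arguments that turn around a vertex rest on this. *)
Lemma rot_closed v (P : pred (vertex G)) u w :
    (forall x, adj v x -> P x -> P (rot v x)) ->
  adj v u -> P u -> adj v w -> P w.
Proof.
move=> Pcl vu Pu vw.
have : w \in porbit (rot v) u by rewrite (rot_cyclic vu) inE.
case/porbitP=> i ->; suff: adj v ((rot v ^+ i)%g u) && P ((rot v ^+ i)%g u).
  by case/andP.
elim: i => [|i /andP[va Pa]]; first by rewrite expg0 perm1 vu.
by rewrite expgSr permM rot_adj // Pcl.
Qed.

(** An injective self-map of a finite set is surjective. *)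
Lemma step_onto S d :
  (forall d', d' \in S -> face_step d' \in S) -> d \in S ->
  exists2 d', d' \in S & d = face_step d'.
Proof.
move=> Scl Sd; have /eqP eqS : @face_step G @: S == S.
  rewrite eqEcard card_imset ?leqnn ?andbT; last exact: face_step_inj.
  by apply/subsetP=> _ /imsetP[x Sx ->]; apply: Scl.
by move: Sd; rewrite -{1}eqS => /imsetP[d' ? ->]; exists d'.
Qed.

Lemma step_neq d : d \in darts G -> face_step d != d.
Proof. by case: d => u v /dart_neq /=; apply: contraNneq => -[->]. Qed.

Lemma card_le1_eq (T : finType) (C : {set T}) x y :
  #|C| <= 1 -> x \in C -> y \in C -> x = y.
Proof. by move=> /card_le1P C1 /C1 Cx /[!Cx] /eqP. Qed.

(* Walking along S from a dart (u, v) gives (v, w) and (w, x) with u, v, w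
   distinct. *)
Lemma card_circulation S :
    S \subset darts G -> S != set0 -> {in S, forall d, opp d \notin S} ->
    {in S, forall d, exists2 d', d' \in S & d'.1 = d.2} ->
  3 <= #|S|.
Proof.
move=> /subsetP SG /set0Pn[[u v] S0] Srev Snext.
have [[v1 w] S1 /= ev1] := Snext _ S0; rewrite {}ev1 in S1.
have [[w1 x] S2 /= ew1] := Snext _ S1; rewrite {}ew1 in S2.
have uv := dart_neq (SG _ S0); have vw := dart_neq (SG _ S1).
have uw : u != w by apply: contraTneq S0 => ->; apply: (Srev _ S1).
have : uniq [:: (u, v); (v, w); (w, x)].
  by rewrite /= !inE !xpair_eqE !negb_or !negb_and /= in uv vw *; rewrite uv vw uw.
move/card_uniqP => /= <-; apply: subset_leq_card.
by apply/subsetP=> d; rewrite !inE => /or3P[] /eqP->.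
Qed.

Definition outs S v := [set d in S | d.1 == v].
Definition ins S v := [set d in S | d.2 == v].

(** Six darts are exhibited: two out of [v], two into [v] (by balance), and one leaving each of the
    two heads. As no two darts are opposite, the heads differ from the tails of the incoming darts,
    so the six are distinct. *)
Lemma card_circulation2 S v :
    S \subset darts G -> {in S, forall d, opp d \notin S} ->
    (forall x, #|outs S x| = #|ins S x|) ->
  1 < #|outs S v| -> 6 <= #|S|.
Proof.
move=> /subsetP SG Srev Sbal v2; have v2' := v2; rewrite Sbal in v2'.
have [d1 [d2]] := card_gt1P v2; case=> /[!inE].
case: d1 d2 => [v1 w1] [v3 w2] /= /andP[S1 /eqP e1] /andP[S2 /eqP e2]; subst v1 v3.
rewrite xpair_eqE eqxx /= => w12.
have [d1 [d2]] := card_gt1P v2'; case=> /[!inE].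
case: d1 d2 => [x1 v1] [x2 v3] /= /andP[S3 /eqP e1] /andP[S4 /eqP e2]; subst v1 v3.
rewrite xpair_eqE eqxx andbT /= => x12.
have next w : (v, w) \in S -> exists y, (w, y) \in S.
  move=> Sw; have : 0 < #|outs S w|.
    by rewrite Sbal; apply/card_gt0P; exists (v, w); rewrite inE Sw /=.
  by case/card_gt0P=> -[w' y]; rewrite inE => /andP[Sy /eqP /= <-]; exists y.
have [y1 S5] := next _ S1; have [y2 S6] := next _ S2.
have vw1 := dart_neq (SG _ S1); have vw2 := dart_neq (SG _ S2).
have vx1 := dart_neq (SG _ S3); have vx2 := dart_neq (SG _ S4).
have ne x w : (x, v) \in S -> (v, w) \in S -> x != w.
  by move=> Sx Sw; apply: contraTneq Sx => ->; apply: (Srev _ Sw).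
have ne11 := ne _ _ S3 S1; have ne12 := ne _ _ S3 S2.
have ne21 := ne _ _ S4 S1; have ne22 := ne _ _ S4 S2.
have : uniq [:: (v, w1); (v, w2); (x1, v); (x2, v); (w1, y1); (w2, y2)].
  rewrite /= !inE !xpair_eqE !negb_or !negb_and /= in vw1 vw2 vx1 vx2 *.
  rewrite eqxx vw1 vw2 w12 x12 ne11 ne12 ne21 ne22 /=.
  by rewrite (eq_sym v x1) (eq_sym v x2) vx1 vx2.
move/card_uniqP => /= <-; apply: subset_leq_card; apply/subsetP=> d.
by rewrite !inE => /orP[|/orP[|/orP[|/orP[|/orP[|]]]]] /eqP->.
Qed.

Lemma card_offdiag (T : finType) (X : {set T}) :
  #|[set p : T * T | [&& p.1 \in X, p.2 \in X & p.1 != p.2]]| = #|X| * (#|X|).-1.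
Proof.
have -> : [set p : T * T | [&& p.1 \in X, p.2 \in X & p.1 != p.2]]
          = setX X X :\: [set (x, x) | x in X].
  apply/setP=> -[x y]; rewrite !inE /=.
  apply/and3P/and3P=> [[xX yX xy]|[xy xX yX]]; split=> //.
    by apply: contraNN xy => /imsetP[z _ [-> ->]].
  by apply: contraNneq xy => ->; apply/imsetP; exists y.
rewrite cardsD (setIidPr _); last first.
  by apply/subsetP=> _ /imsetP[x xX ->]; rewrite inE xX.
rewrite cardsX card_imset; last by move=> x y [].
by rewrite -subn1 mulnBr muln1.
Qed.

Definition within S (X : {set vertex G}) :=
  [set d in S | (d.1 \in X) && (d.2 \in X)].

(** The set [E], the darts of [S] inside [X], and the opposites of the latter are pairwise disjoint
    sets of ordered pairs of distinct vertices of [X]. *)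
Lemma card_within S X E :
    S \subset darts G -> {in S, forall d, opp d \notin S} ->
    E \subset darts G -> {in E, forall d, d.1 \in X /\ d.2 \in X} ->
    {in S, forall d, d \notin E /\ opp d \notin E} ->
  #|E| + (#|within S X|).*2 <= #|X| * (#|X|).-1.
Proof.
move=> /subsetP SG Srev /subsetP EG EX SE; rewrite -card_offdiag.
set W := within S X; set W' := opp @: W.
have cW' : #|W'| = #|W| by rewrite card_imset //; apply: opp_inj.
have d1 : [disjoint W & W'].
  rewrite -setI_eq0; apply/eqP/setP=> d; rewrite !inE; apply/negP.
  case/andP=> /andP[dS _] /imsetP[d' /setIdP[d'S _] dd'].
  by move: (Srev _ d'S); rewrite -dd' dS.
have d2 : [disjoint E & W :|: W'].
  rewrite -setI_eq0; apply/eqP/setP=> d; rewrite in_setI in_setU in_set0.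
  apply/negP=> /andP[dE /orP[/setIdP[/SE[]]|/imsetP[d' /setIdP[/SE[_ +] _] dd']]].
    by rewrite dE.
  by rewrite -dd' dE.
have <- : #|E :|: (W :|: W')| = #|E| + #|W|.*2.
  rewrite cardsU (disjoint_setI0 d2) cards0 subn0 cardsU (disjoint_setI0 d1).
  by rewrite cards0 subn0 cW' addnn.
apply: subset_leq_card; apply/subsetP=> d; rewrite !in_setU [in X in _ -> X]inE.
case/or3P=> [dE|/setIdP[dS /andP[-> ->]]|/imsetP[d' /setIdP[dS /andP[x y]] ->]].
- by have [-> ->] := EX _ dE; rewrite dart_neq // EG.
- by rewrite dart_neq // SG.
- by rewrite x y eq_sym dart_neq // SG.
Qed.
End Darts.

(** * The two sides of a cut face *)

Section Split.
Variable G : emap.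
Local Notation dart := (vertex G * vertex G)%type.
Local Notation step := (@face_step G).
Implicit Types (d : dart) (S : {set dart}) (v : vertex G).

(* F consists of the darts of the cut face, A and B of those of the faces in
   two classes that are not linked in the dual without F. *)
Record dual_split (F A B : {set dart}) : Prop := DualSplit {
  split_cover : forall d, (d \in darts G) = [|| d \in F, d \in A | d \in B];
  split_FA : forall d, d \in F -> d \notin A;
  split_FB : forall d, d \in F -> d \notin B;
  split_AB : forall d, d \in A -> d \notin B;
  split_orbit : {in F &, forall d d', fconnect step d d'};
  split_stepF : forall d, d \in F -> step d \in F;
  split_stepA : forall d, d \in A -> step d \in A;
  split_stepB : forall d, d \in B -> step d \in B;
  split_loop : forall d, d \in F -> opp d \notin F;
  split_opp : forall d, d \in A -> opp d \notin B;
  split_simple : {in F &, forall d d', fconnect step (opp d) (opp d') -> d = d'};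
  split_A0 : A != set0;
  split_B0 : B != set0
}.

Lemma dual_split_sym F A B : dual_split F A B -> dual_split F B A.
Proof.
case=> cov FA FB AB orb sF sA sB lp rv sm A0 B0; split=> // d.
- by rewrite cov [(d \in A) || _]orbC.
- by move=> dB; apply: contraL dB => /AB.
- by move=> dB; apply: contraL dB => /rv; rewrite oppK.
Qed.

(** An edge between [F] and [A] is attributed to [A] in both directions; this way the two sides
    partition the darts of the map. *)
Definition side_darts (A : {set dart}) := [set d | (d \in A) || (opp d \in A)].
Definition boundary (F A : {set dart}) := [set d in F | opp d \in A].
Definition side_vertices (A : {set dart}) := [set d.1 | d in side_darts A].

Lemma side_darts_opp A d : (opp d \in side_darts A) = (d \in side_darts A).
Proof. by rewrite !inE oppK orbC. Qed.

Section OneSide.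
Variables F A B : {set dart}.
Hypothesis s : dual_split F A B.
Let X := side_vertices A :&: side_vertices B.

Lemma side_dartsE d : (d \in side_darts A) = (d \in A) || (d \in boundary F A).
Proof.
rewrite !inE; case: (boolP (d \in A)) => //= dA.
case rA: (opp d \in A); last by rewrite andbF.
have : d \in darts G by rewrite -opp_dart (split_cover s) rA orbT.
rewrite (split_cover s) (negbTE dA) /= andbT => /orP[-> //|dB].
by have := split_opp s rA; rewrite oppK dB.
Qed.

Lemma side_darts_disj d : d \in side_darts A -> d \notin side_darts B.
Proof.
rewrite !inE negb_or => /orP[dA|dA].
  by rewrite (split_AB s dA) (split_opp s dA).
by rewrite (split_AB s dA) andbT; have := split_opp s dA; rewrite oppK.
Qed.

Lemma side_darts_sub : side_darts A \subset darts G.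
Proof.
apply/subsetP=> d; rewrite inE => /orP[] dA; last rewrite -opp_dart;
  by rewrite (split_cover s) dA orbT.
Qed.

Lemma boundary_sub : boundary F A \subset darts G.
Proof.
by apply/subsetP=> d /setIdP[dF _]; rewrite (split_cover s) dF.
Qed.

Lemma boundary_opp : {in boundary F A, forall d, opp d \notin boundary F A}.
Proof.
by move=> d /setIdP[dF _]; rewrite inE (negbTE (split_loop s dF)).
Qed.

Lemma boundary_side d : d \in boundary F A -> d \in side_darts A.
Proof. by rewrite side_dartsE => ->; rewrite orbT. Qed.

Lemma darts_cover d : d \in darts G -> (d \in side_darts A) || (d \in side_darts B).
Proof.
move=> dG; have := dG; rewrite (split_cover s) !inE.
case/or3P=> [dF|->|->]; rewrite ?orbT //.
have := dG; rewrite -opp_dart (split_cover s) (negbTE (split_loop s dF)) /=.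
by case/orP=> ->; rewrite !orbT.
Qed.

Lemma card_face_split : #|F| = #|boundary F A| + #|boundary F B|.
Proof.
have eF : F = boundary F A :|: boundary F B.
  apply/setP=> d; rewrite !inE -andb_orr; case: (boolP (d \in F)) => //= dF.
  have : opp d \in darts G by rewrite opp_dart (split_cover s) dF.
  by rewrite (split_cover s) (negbTE (split_loop s dF)).
rewrite [in LHS]eF cardsU disjoint_setI0 ?cards0 ?subn0 //.
rewrite -setI_eq0; apply/eqP/setP=> d; rewrite !inE; apply/negP.
by case/andP=> /andP[_ dA] /andP[_]; apply/negP/(split_AB s).
Qed.

(** The side of [A] is balanced at [v] because it is closed under reversal, and [A] is balanced
    because facial walks run through [v]. The boundary is the difference of the two. *)
Lemma boundary_balanced v : #|outs (boundary F A) v| = #|ins (boundary F A) v|.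
Proof.
have disj d : d \in boundary F A -> d \notin A by case/setIdP => /(split_FA s).
have eo : outs (side_darts A) v = outs A v :|: outs (boundary F A) v.
  by apply/setP=> d; rewrite [LHS]inE side_dartsE andb_orl in_setU ![d \in [set _ in _ | _]]inE.
have ei : ins (side_darts A) v = ins A v :|: ins (boundary F A) v.
  by apply/setP=> d; rewrite [LHS]inE side_dartsE andb_orl in_setU ![d \in [set _ in _ | _]]inE.
have co : #|outs (side_darts A) v| = #|outs A v| + #|outs (boundary F A) v|.
  rewrite eo cardsU disjoint_setI0 ?cards0 ?subn0 // disjoint_sym.
  rewrite disjoint_subset; apply/subsetP=> d /setIdP[/disj dA _].
  by rewrite !inE (negbTE dA).
have ci : #|ins (side_darts A) v| = #|ins A v| + #|ins (boundary F A) v|.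
  rewrite ei cardsU disjoint_setI0 ?cards0 ?subn0 // disjoint_sym.
  rewrite disjoint_subset; apply/subsetP=> d /setIdP[/disj dA _].
  by rewrite !inE (negbTE dA).
have c1 : #|ins (side_darts A) v| = #|outs (side_darts A) v|.
  rewrite -(card_imset _ (@opp_inj G)); apply: eq_card => d.
  apply/imsetP/setIdP => [[d' /setIdP[d'A /eqP<-] ->]|[dA /eqP<-]].
    by rewrite side_darts_opp d'A /=.
  by exists (opp d); rewrite ?oppK // inE side_darts_opp dA /=.
have c2 : #|ins A v| = #|outs A v|.
  rewrite -(card_imset _ (@face_step_inj G)); apply: eq_card => d.
  apply/imsetP/setIdP => [[d' /setIdP[d'A /eqP<-] ->]|[dA /eqP<-]].
    by rewrite (split_stepA s d'A) /=.
  have [d' d'A ->] := step_onto (split_stepA s) dA.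
  by exists d' => //; rewrite inE d'A /=.
by apply/(@addnI #|outs A v|); rewrite -co -c1 ci c2.
Qed.

Lemma boundary_next d :
  d \in boundary F A -> exists2 d', d' \in boundary F A & d'.1 = d.2.
Proof.
move=> dA; have : 0 < #|outs (boundary F A) d.2|.
  by rewrite boundary_balanced; apply/card_gt0P; exists d; rewrite inE dA /=.
by case/card_gt0P=> d' /setIdP[? /eqP]; exists d'.
Qed.

Lemma side_vertexP v : reflect (exists u, (v, u) \in side_darts A) (v \in side_vertices A).
Proof.
apply: (iffP imsetP) => [[[x u] dA ->]|[u dA]]; first by exists u.
by exists (v, u).
Qed.

(* Leaving v without crossing the boundary of A, the rotation at v never leaves
   the side of A. *)
Lemma side_rot v u : (u, v) \in side_darts A -> (u, v) \notin boundary F A ->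
  (rot v u, v) \in side_darts A.
Proof.
rewrite side_dartsE => /orP[dA _|-> //]; rewrite -side_darts_opp inE.
by rewrite (split_stepA s dA).
Qed.
End OneSide.

Section Cross.
Variables F A B : {set dart}.
Hypothesis s : dual_split F A B.

(** Without a boundary dart of [A] into [v], the rotation at [v] would stay on the side of [A]
    forever and never meet the dart on the side of [B]. *)
Lemma boundary_in v : v \in side_vertices A -> v \in side_vertices B ->
  exists u, (u, v) \in boundary F A.
Proof.
move=> /side_vertexP[u vu] /side_vertexP[w vw].
have [/existsP //|] := boolP [exists u, (u, v) \in boundary F A].
rewrite negb_exists => /forallP no.
have au : adj v u by have := subsetP (side_darts_sub s) _ vu; rewrite inE.
have aw : adj v w.
  by have := subsetP (side_darts_sub (dual_split_sym s)) _ vw; rewrite inE.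
have : (w, v) \in side_darts A.
  apply: (rot_closed (P := fun x => (x, v) \in side_darts A) _ au _ aw).
    by move=> x _ xv; apply: (side_rot s xv).
  by rewrite -side_darts_opp.
rewrite -side_darts_opp => /(side_darts_disj s).
by rewrite vw.
Qed.

Lemma boundary_out v : v \in side_vertices A -> v \in side_vertices B ->
  exists u, (v, u) \in boundary F A.
Proof.
move=> vA vB; have [u uv] := boundary_in vA vB.
by have [[v' w] d /= e] := boundary_next s uv; exists w; rewrite -e.
Qed.
End Cross.

End Split.

(** * Lower bounds on the cut face *)

Lemma connect_ind (T : finType) (e : rel T) (P : pred T) x y :
  (forall u v, e u v -> P u -> P v) -> connect e x y -> P x -> P y.
Proof.
move=> Pe /connectP[p + ->]; elim: p x => //= z p IH x /andP[xz zp] Px.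
exact: IH zp (Pe _ _ xz Px).
Qed.

(** Arithmetic for a side with all [n] vertices shared: [a] and [b] are the sizes of the two
    boundaries, [e] counts the darts of the side, and [w] the darts of the other boundary joining
    two of the [n] vertices. From [n = 8] on, [a + b] is at least 16; the smaller values are treated
    one by one. *)
Lemma inside_arith n a b e w f :
    f = a + b -> 4 * a <= e -> n <= a -> n <= b -> 0 < n ->
    e + w.*2 <= n * n.-1 -> n.*2 <= b + w ->
  14 <= f /\ (f = 14 -> [/\ n = 7, a = 7, e = 28 & w = 7]).
Proof.
move=> fE ae na nb n0 ew bw; have : n < 8 \/ 14 < f by lia.
case: n na nb n0 ew bw => [|[|[|[|[|[|[|[|n]]]]]]]] //= na nb _ ew bw _.
all: split; [lia | move=> f14; split; lia].
Qed.

Section Count.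
Variable G : emap.
Local Notation dart := (vertex G * vertex G)%type.
Local Notation step := (@face_step G).
Implicit Types (d : dart) (S : {set dart}) (v : vertex G).

(** Each vertex of [X] is the tail of a dart of [S] and the head of one; only the darts inside [X]
    are counted for both purposes. *)
Lemma card_ends S (X : {set vertex G}) :
    {in X, forall x, exists u, (x, u) \in S} ->
    {in X, forall x, exists u, (u, x) \in S} ->
  #|X|.*2 <= #|S| + #|within S X|.
Proof.
move=> Xout Xin; set O := [set d in S | d.1 \in X]; set I := [set d in S | d.2 \in X].
have cO : #|X| <= #|O|.
  apply: leq_trans (leq_imset_card fst O); apply: subset_leq_card.
  apply/subsetP=> x xX; have [u xu] := Xout _ xX.
  by apply/imsetP; exists (x, u); rewrite // inE xu.
have cI : #|X| <= #|I|.
  apply: leq_trans (leq_imset_card snd I); apply: subset_leq_card.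
  apply/subsetP=> x xX; have [u xu] := Xin _ xX.
  by apply/imsetP; exists (u, x); rewrite // inE xu.
have <- : #|O :&: I| = #|within S X|.
  by apply: eq_card => d; rewrite !inE; case: (d \in S).
have cOI : #|O :|: I| <= #|S|.
  by apply: subset_leq_card; apply/subsetP=> d; rewrite !inE => /orP[] /andP[].
rewrite -addnn (leq_trans (leq_add cO cI)) // -[#|O| + _]cardsUI.
by rewrite leq_add2r.
Qed.

Section Split.
Variables F A B : {set dart}.
Hypothesis s : dual_split F A B.
Let s' := dual_split_sym s.
Let X := side_vertices A :&: side_vertices B.

Lemma shared_inA x : x \in X -> exists u, (u, x) \in boundary F A.
Proof. by case/setIP=> xA xB; apply: boundary_in s _ xA xB. Qed.

Lemma shared_outA x : x \in X -> exists u, (x, u) \in boundary F A.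
Proof. by case/setIP=> xA xB; apply: boundary_out s _ xA xB. Qed.

Lemma shared_inB x : x \in X -> exists u, (u, x) \in boundary F B.
Proof. by case/setIP=> xA xB; apply: boundary_in s' _ xB xA. Qed.

Lemma shared_outB x : x \in X -> exists u, (x, u) \in boundary F B.
Proof. by case/setIP=> xA xB; apply: boundary_out s' _ xB xA. Qed.

(** A walk can change sides only at a shared vertex, and all of these lie in [S]. *)
Lemma split_separates (S : {set vertex G}) u w :
    connected_on (@adj G) ([set: vertex G] :\: S) -> X \subset S ->
    u \in side_vertices A -> u \notin S -> w \in side_vertices B -> w \notin S ->
  False.
Proof.
move=> con XS uA uS wB wS.
have /con : u \in setT :\: S by rewrite !inE uS.
move=> /(_ w); rewrite !inE wS => /(_ isT) cuw.
have noX x : x \notin S -> x \in side_vertices A -> x \notin side_vertices B.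
  by move=> xS xA; apply: contraNN xS => xB; rewrite (subsetP XS) // inE xA.
suff : w \in side_vertices A by move=> wA; have := noX _ wS wA; rewrite wB.
apply: connect_ind cuw uA => x y /=; rewrite !inE !andbT => /and3P[xS yS xy] xA.
have : (x, y) \in darts G by rewrite inE.
case/(darts_cover s)/orP => [xyA|xyB].
  by apply/side_vertexP; exists x; rewrite -side_darts_opp.
by have /negP[] := noX _ xS xA; apply/side_vertexP; exists y.
Qed.

Lemma side_vertices_neq0 : side_vertices A != set0.
Proof.
have /set0Pn[d dA] := split_A0 s; apply/set0Pn; exists d.1.
by apply/imsetP; exists d; rewrite ?inE ?dA.
Qed.
End Split.

Section Inequalities.
Variables F A B : {set dart}.
Hypothesis s : dual_split F A B.
Let s' := dual_split_sym s.
Let X := side_vertices A :&: side_vertices B.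

Lemma shared_neq0 : X != set0.
Proof.
apply/eqP=> X0.
have /set0Pn[u uA] := side_vertices_neq0 s; have /set0Pn[w wB] := side_vertices_neq0 s'.
apply: (@split_separates _ _ _ s set0 u w _ _ uA _ wB); rewrite ?inE //.
  by rewrite setD0; apply: adj_connected.
by rewrite -/X X0.
Qed.

Lemma boundary_ge3 : 3 <= #|boundary F A|.
Proof.
apply: card_circulation (boundary_sub s) _ (boundary_opp s) _.
  have /set0Pn[x /(shared_inA s)[u ux]] := shared_neq0; by apply/set0Pn; exists (u, x).
by move=> d dA; apply: boundary_next s _ dA.
Qed.

Lemma boundary_ge_shared : #|X| <= #|boundary F A|.
Proof.
apply: leq_trans (leq_imset_card fst _); apply: subset_leq_card.
by apply/subsetP=> x /(shared_outA s)[u xu]; apply/imsetP; exists (x, u).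
Qed.

Lemma face_sub : F \subset darts G.
Proof. by apply/subsetP=> d dF; rewrite (split_cover s) dF. Qed.

(** Write k for the number of shared vertices and w for the number of darts of [F] joining two of
    them. Counting ends on both boundaries gives 4k <= |F| + w, and counting pairs gives 2w <=
    k(k-1). *)
Lemma face_bound_within : 8 * #|X| <= #|F|.*2 + #|X| * (#|X|).-1.
Proof.
have cA := card_ends (shared_outA s) (shared_inA s).
have cB := card_ends (shared_outB s) (shared_inB s).
have cF := card_face_split s; rewrite -/X in cA cB.
have cW : #|within (boundary F A) X| + #|within (boundary F B) X| <= #|within F X|.
  rewrite -cardsUI disjoint_setI0 ?cards0 ?addn0.
    apply: subset_leq_card; apply/subsetP=> d; rewrite !inE.
    by case/orP=> /andP[/andP[-> _] ->].
  rewrite -setI_eq0; apply/eqP/setP=> d; rewrite !inE; apply/negP.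
  case/andP=> /andP[/andP[_ dA] _] /andP[/andP[_ dB] _].
  by have := split_AB s dA; rewrite dB.
have EX : {in (set0 : {set dart}), forall d, d.1 \in X /\ d.2 \in X}.
  by move=> d; rewrite inE.
have FE : {in F, forall d, d \notin (set0 : {set dart}) /\ opp d \notin (set0 : {set dart})}.
  by move=> d _; rewrite !inE.
have := card_within face_sub (split_loop s) (sub0set _) EX FE.
by rewrite cards0; lia.
Qed.

(** Three consecutive darts of the face across [d]; they are the whole face when it is a
    triangle. *)
Definition apexes d : seq dart := [:: opp d; step (opp d); step (step (opp d))].

(** If the face across [d] closed up after two steps, it would contain [d] itself, which lies in
    [F]. *)
Lemma side_face_uniq d : d \in boundary F A -> uniq (apexes d).
Proof.
move=> /setIdP[dF dA].
have dG : opp d \in darts G by rewrite opp_dart (split_cover s) dF.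
have n1 := step_neq dG; have n2 := step_neq (step_dart dG).
have uniq3 (x y z : dart) : y != x -> z != y -> z != x -> uniq [:: x; y; z].
  by rewrite /= !inE !negb_or !(eq_sym z) (eq_sym y) => -> -> ->.
apply: uniq3 n1 n2 _.
have := split_FA s dF; apply: contraNneq => e.
suff -> : d = step (opp d) by apply: (split_stepA s).
by case: d {dF dA dG} e => u v [/= e _]; rewrite /face_step /= e.
Qed.

Lemma fconnect_apexes d x : x \in apexes d -> fconnect step (opp d) x.
Proof.
by rewrite !inE => /or3P[] /eqP->; [|exact: (fconnect_iter _ 1)|exact: (fconnect_iter _ 2)].
Qed.

(** A common dart puts [opp d] and [opp d'] on the same face, and the dual has no two parallel edges
    at [F]. *)
Lemma apexes_inj d d' x : d \in boundary F A -> d' \in boundary F A ->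
  x \in apexes d -> x \in apexes d' -> d = d'.
Proof.
move=> /setIdP[dF _] /setIdP[dF' _] /fconnect_apexes cx /fconnect_apexes cx'.
apply: (split_simple s) => //; apply: connect_trans cx _.
by rewrite (fconnect_sym (@face_step_inj G)).
Qed.

Definition side_triangles := [set x | [exists d in boundary F A, x \in apexes d]].

Lemma side_triangles_sub : side_triangles \subset A.
Proof.
apply/subsetP=> x; rewrite inE => /exists_inP[d /setIdP[_ dA]].
by rewrite !inE => /or3P[] /eqP-> //; rewrite !(split_stepA s).
Qed.

Lemma card_side_triangles : #|side_triangles| = 3 * #|boundary F A|.
Proof.
have -> : side_triangles = cover [set [set x in apexes d] | d in boundary F A].
  apply/setP=> x; rewrite inE; apply/exists_inP/bigcupP.
    case=> d dA xd; exists [set y in apexes d]; last by rewrite inE.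
    by apply/imsetP; exists d.
  by case=> _ /imsetP[d dA ->]; rewrite inE; exists d.
have cd d : d \in boundary F A -> #|[set x in apexes d]| = 3.
  by move=> dA; rewrite cardsE (card_uniqP (side_face_uniq dA)).
have inj : {in boundary F A &, injective (fun d => [set x in apexes d])}.
  move=> d d' dA dA' /setP/(_ (opp d)); rewrite !inE eqxx /= => /esym od.
  by apply: (apexes_inj (x := opp d) dA dA'); rewrite !inE ?eqxx.
have tr : trivIset [set [set x in apexes d] | d in boundary F A].
  apply/trivIsetP=> _ _ /imsetP[d dA ->] /imsetP[d' dA' ->] ne.
  rewrite -setI_eq0; apply/eqP/setP=> x; rewrite in_set0 in_setI !in_set.
  apply/negP=> /andP[xd xd']; case/eqP: ne.
  by rewrite (apexes_inj dA dA' xd xd').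
rewrite -(eqP tr) (eq_bigr (fun=> 3)); last by move=> _ /imsetP[d dA ->]; apply: cd.
by rewrite sum_nat_const (card_in_imset inj) mulnC.
Qed.

Lemma card_side_darts : #|side_darts A| = #|A| + #|boundary F A|.
Proof.
have -> : side_darts A = A :|: boundary F A.
  by apply/setP=> d; rewrite (side_dartsE s) in_setU.
rewrite cardsU disjoint_setI0 ?cards0 ?subn0 //.
rewrite -setI_eq0; apply/eqP/setP=> d; rewrite in_setI in_set0.
by apply/negP=> /andP[dA /setIdP[/(split_FA s)]]; rewrite dA.
Qed.

(** Each boundary dart accounts for itself and for three darts of the face across it. *)
Lemma card_side_ge : 4 * #|boundary F A| <= #|side_darts A|.
Proof.
have sub := side_triangles_sub.
by rewrite card_side_darts mulSn addnC leq_add2r -card_side_triangles subset_leq_card //.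
Qed.
End Inequalities.

Section Inside.
Variables F A B : {set dart}.
Hypothesis s : dual_split F A B.
Let s' := dual_split_sym s.
Hypothesis AB : side_vertices A \subset side_vertices B.
Let V := side_vertices A.

(** All vertices of [V] are shared, so both boundaries have at least |V| darts, while the darts on
    the side of [A] and the darts of the other boundary inside [V], with their opposites, compete
    for the ordered pairs of [V]. *)
Lemma card_inside :
  14 <= #|F| /\
  (#|F| = 14 -> [/\ #|V| = 7, #|boundary F A| = 7, #|side_darts A| = 28
                 & #|within (boundary F B) V| = 7]).
Proof.
have eX : side_vertices A :&: side_vertices B = V by apply/setIidPl.
have cF := card_face_split s.
have c1 := card_side_ge s.
have c2 := boundary_ge_shared s; have c3 := boundary_ge_shared s'.
rewrite setIC in c3; rewrite eX in c2 c3.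
have V0 : 0 < #|V| by rewrite card_gt0; apply: side_vertices_neq0 s.
have c4 : #|side_darts A| + (#|within (boundary F B) V|).*2 <= #|V| * (#|V|).-1.
  apply: card_within (boundary_sub s') (boundary_opp s') (side_darts_sub s) _ _.
    move=> d dA; split; first by apply/imsetP; exists d.
    by apply/imsetP; exists (opp d); rewrite ?side_darts_opp.
  move=> d /(boundary_side s')/(side_darts_disj s') dB; split => //.
  by rewrite side_darts_opp.
have c5 : #|V|.*2 <= #|boundary F B| + #|within (boundary F B) V|.
  by rewrite -eX; apply: card_ends; [exact: (shared_outB s) | exact: (shared_inB s)].
exact: inside_arith cF c1 c2 c3 V0 c4 c5.
Qed.
End Inside.
End Count.

(** * Excluding a cut face of size 14 when all vertices of one side are shared *)

Lemma card_involution_even (T : finType) (t : T -> T) (V : {set T}) :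
  {in V, forall v, [/\ t v \in V, t v != v & t (t v) = v]} -> ~~ odd #|V|.
Proof.
have [n] := ubnP #|V|; elim: n V => // n IH V; rewrite ltnS => Vn tV.
have [->|[v vV]] := set_0Vmem V; first by rewrite cards0.
have [tvV tvv ttv] := tV _ vV.
rewrite (cardsD1 v) vV (cardsD1 (t v)) !inE tvV tvv /= negbK.
apply: IH.
  by move: Vn; rewrite (cardsD1 v) vV (cardsD1 (t v)) !inE tvV tvv; lia.
move=> u; rewrite !inE => /and3P[utv uv uV]; have [tuV tuu ttu] := tV _ uV.
rewrite tuu ttu tuV andbT; split=> //; apply/andP; split.
  by apply: contraNneq uv => e; rewrite -ttu e ttv.
by apply: contraNneq utv => e; rewrite -ttu e.
Qed.

Lemma card_setD3_le (T : finType) (V : {set T}) x y z :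
  #|V| <= 3 + #|V :\ x :\ y :\ z|.
Proof.
have D1 (W : {set T}) u : #|W| <= 1 + #|W :\ u|.
  by rewrite (cardsD1 u) leq_add2r leq_b1.
rewrite -[3]/(1 + (1 + 1)) -!addnA (leq_trans (D1 V x)) // leq_add2l.
by rewrite (leq_trans (D1 _ y)) // leq_add2l.
Qed.

Lemma card_setD3 (T : finType) (V : {set T}) x y z :
    x \in V -> y \in V -> z \in V -> y != x -> z != x -> z != y ->
  #|V| = 3 + #|V :\ x :\ y :\ z|.
Proof.
move=> xV yV zV yx zx zy; rewrite (cardsD1 x V) xV (cardsD1 y (V :\ x)).
by rewrite (cardsD1 z (V :\ x :\ y)) !in_setD1 yx yV zx zy zV.
Qed.

Section Extremal.
Variable G : emap.
Local Notation dart := (vertex G * vertex G)%type.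
Local Notation step := (@face_step G).
Implicit Types (d : dart) (S : {set dart}) (v : vertex G).

Lemma imset_eq_inj (T U : finType) (f : T -> U) (S : {set T}) (V : {set U}) :
  V \subset f @: S -> #|S| <= #|V| -> {in S &, injective f}.
Proof.
move=> VS SV; apply/imset_injP; rewrite eqn_leq leq_imset_card.
exact: leq_trans SV (subset_leq_card VS).
Qed.

Section Inside.
Variables F A B : {set dart}.
Hypothesis s : dual_split F A B.
Let s' := dual_split_sym s.
Hypothesis AB : side_vertices A \subset side_vertices B.
Let V := side_vertices A.

(* In the extremal case all faces in A are triangles with one edge on F, and
   each vertex v has four edges in A: the middle one of its three triangles has
   its edge on F opposite to v.  If t v is the apex of the triangle on the
   boundary dart into v, this forces t (t v) = v. *)
Lemma inside_face_neq14 : #|F| <> 14.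
Proof.
move=> F14; have [_ /(_ F14)[cV ca ce cw]] := card_inside s AB; rewrite -/V in cV cw.
have inA v : v \in V -> exists u, (u, v) \in boundary F A.
  by move=> vV; apply: boundary_in s _ vV (subsetP AB _ vV).
have inB v : v \in V -> exists u, (u, v) \in boundary F B.
  by move=> vV; apply: boundary_in s' _ (subsetP AB _ vV) vV.
have outB v : v \in V -> exists u, (v, u) \in boundary F B.
  by move=> vV; apply: boundary_out s' _ (subsetP AB _ vV) vV.
have cb : #|boundary F B| = 7 by apply: (@addnI 7); rewrite -{1}ca -card_face_split.
have wB d : d \in boundary F B -> d.1 \in V /\ d.2 \in V.
  have /eqP <- : within (boundary F B) V == boundary F B.
    rewrite eqEcard cw cb leqnn andbT.
    by apply/subsetP=> x /setIdP[].
  by case/setIdP=> _ /andP[].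
(* Seven boundary darts enter each of the seven vertices of [V], hence each exactly once. *)
have injI : {in boundary F A &, injective snd}.
  apply: (@imset_eq_inj _ _ _ _ V); last by rewrite ca cV.
  by apply/subsetP=> v /inA[u uv]; apply/imsetP; exists (u, v).
have sideV x y : (x, y) \in side_darts A -> x \in V /\ y \in V.
  move=> xy; split; apply/side_vertexP; first by exists y.
  by exists x; rewrite -side_darts_opp.
pose N v := [set u | (v, u) \in side_darts A].
have NE v u : (u \in N v) = ((v, u) \in side_darts A) by rewrite in_set.
have cN v : #|N v| = #|outs (side_darts A) v|.
  rewrite -(card_imset _ (fun x y => @congr1 _ _ snd (v, x) (v, y))).
  apply: eq_card => d; apply/imsetP/setIdP => [[u + ->]|[]].
    by rewrite NE.
  by case: d => v' u dA /= /eqP e; subst v'; exists u; rewrite ?NE.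
(* Of the six other vertices of [V], two are already joined to [v] by edges of the other
   boundary. *)
have cN4 v : v \in V -> #|N v| <= 4.
  move=> vV; have [p pv] := inB _ vV; have [q vq] := outB _ vV.
  have [pV _] := wB _ pv; have [_ qV] := wB _ vq; rewrite /= in pV qV.
  have BG := subsetP (boundary_sub s').
  have qv : q != v by rewrite eq_sym; apply: dart_neq (BG _ vq).
  have pnv : p != v by apply: dart_neq (BG _ pv).
  have qp : q != p.
    by apply: contraTneq pv => <-; apply: (boundary_opp s' vq).
  have sub : N v \subset V :\ v :\ p :\ q.
    apply/subsetP=> u; rewrite NE => vu; have [_ uV] := sideV _ _ vu.
    rewrite !in_setD1 uV andbT; apply/and3P; split.
    - by apply: contraTneq vu => ->; apply/(side_darts_disj s')/(boundary_side s').
    - apply: contraTneq vu => ->; rewrite -side_darts_opp.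
      exact/(side_darts_disj s')/(boundary_side s').
    - by rewrite eq_sym; have := dart_neq (subsetP (side_darts_sub s) _ vu).
  apply: leq_trans (subset_leq_card sub) _; rewrite -(leq_add2l 3).
  by rewrite -card_setD3 ?cV.
(* The 28 darts of the side leave seven vertices, at most four from each, so equality holds
   everywhere. *)
have N4 v : v \in V -> 4 <= #|N v|.
  move=> vV; move: ce; rewrite -sum1_card (partition_big fst (mem V)) /=; last first.
    by case=> x y /sideV[].
  rewrite (eq_bigr (fun v => #|N v|)); last first.
    by move=> u _; rewrite cN -sum1_card; apply: eq_bigl => d; rewrite [RHS]inE.
  rewrite (bigD1 v) //=.
  have : \sum_(i in V | i != v) #|N i| <= 24; last by lia.
  apply: (@leq_trans (\sum_(i in V | i != v) 4)).
    by apply: leq_sum => i /andP[iV _]; apply: cN4.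
  rewrite sum_nat_const (_ : #|_| = 6) //; move: cV; rewrite (cardsD1 v) vV add1n.
  by case=> <-; apply: eq_card => u; rewrite !inE andbC.
(* Indeed |A| = 28 - 7 = 3 * 7. *)
have triA : side_triangles F A = A.
  apply/eqP; rewrite eqEcard (side_triangles_sub s) (card_side_triangles s) ca.
  by have := card_side_darts s; rewrite ca ce => /(@addIn 7 21) <-.
(* The fourth dart of the face again lies in some triple, which must be that of [d]; injectivity of
   the step leaves only its first member. *)
have tri d : d \in boundary F A -> step (step (step (opp d))) = opp d.
  move=> dA; have [_ oA] := setIdP dA.
  have : step (step (step (opp d))) \in side_triangles F A.
    by rewrite triA !(split_stepA s).
  rewrite inE => /exists_inP[d' dA' xd'].
  have dd' : d' = d.
    have [dF _] := setIdP dA; have [dF' _] := setIdP dA'.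
    apply: (split_simple s) => //; apply: connect_trans (fconnect_apexes xd') _.
    by rewrite (fconnect_sym (@face_step_inj G)) (fconnect_iter _ 3).
  subst d'; have := side_face_uniq s dA; rewrite /apexes !inE in xd' *.
  rewrite cons_uniq !inE negb_or => /andP[/andP[/eqP n1 /eqP n2] _].
  case/or3P: xd' => /eqP // /face_step_inj.
    by move=> e; case: n2.
  by move/face_step_inj=> e; case: n1.
(* The triangle across [(w, v)] starts with [(v, w)] and [(w, rot w v)], so [rot w v] is its apex.
   The default [v] does not occur on [V], by [inA]. *)
pose t v := if [pick w | (w, v) \in boundary F A] is Some w then rot w v else v.
have tE w v : (w, v) \in boundary F A -> t v = rot w v.
  move=> wv; rewrite /t; case: pickP => [w' w'v|/(_ w)]; last by rewrite wv.
  by have [->] := injI _ _ w'v wv erefl.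
move: t tE => t tE.
have : ~~ odd #|V|; last by rewrite cV.
apply: (@card_involution_even _ t) => v vV.
have [w wv] := inA _ vV; have tv := tE _ _ wv.
have [wvF wvA] := setIdP wv; rewrite /opp /= in wvA.
have vwA := split_stepA s wvA; rewrite /face_step /= -tv in vwA.
have tvA := split_stepA s vwA.
have := tri _ wv; rewrite /opp /face_step /= -tv in tvA *; move=> [e1 e2].
rewrite e1 in tvA e2.
have tvG := subsetP (side_darts_sub s) (t v, v).
rewrite (side_dartsE s) tvA in tvG; have {}tvG := tvG isT.
have vt : v != t v by rewrite eq_sym; apply: dart_neq tvG.
have tvS : (t v, v) \in side_darts A by rewrite inE tvA.
split; first by have [] := sideV _ _ tvS.
  by rewrite eq_sym.
have : (v, t v) \in side_darts A by rewrite -side_darts_opp.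
rewrite (side_dartsE s) => /orP[|vtF]; last first.
  have : (v, t v) = (w, v).
    apply: (@apexes_inj _ _ _ _ s _ _ (t v, v)) => //; first by rewrite !inE eqxx.
    by rewrite /apexes /opp /face_step /= -tv e1 !inE eqxx !orbT.
  case=> e _; have := dart_neq (subsetP (boundary_sub s) _ wv).
  by rewrite /= -e eqxx.
rewrite -{1}triA inE => /exists_inP[[p q] pq].
rewrite /apexes /opp /face_step /= !inE.
have triq := tri _ pq; rewrite /opp /face_step /= in triq; case: triq => f1 f2.
(* The dart [(v, t v)] lies in the triangle across some boundary dart [(p, q)]; its three possible
   positions are examined in turn. The first would put [(t v, v)] in both [F] and [A]. *)
rewrite f1; case/or3P=> /eqP[ev et].
- by have [/(split_FA s)] := setIdP pq; rewrite -ev -et tvA.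
(* Here q, t v, w are consecutive around [v], from a boundary dart out of [v] to one into [v]. The
   rotation started at a fourth neighbour on the side of [A] avoids all three, although it has to
   reach [w]. *)
- subst p; exfalso.
  have vw : adj v w by have := subsetP (boundary_sub s) _ wv; rewrite inE adj_sym.
  have [u] : exists u, u \in N v :\ q :\ t v :\ w.
    apply/set0Pn; rewrite -card_gt0.
    rewrite -(ltn_add2l 3) addn0.
    exact: leq_trans (N4 _ vV) (card_setD3_le _ _ _ _).
  rewrite !in_setD1 NE => /and4P[uw ut uq vu].
  pose P x := [&& x != w, x != t v, x != q & (v, x) \in side_darts A].
  suff : P w by rewrite /P eqxx.
  apply: (rot_closed (P := P) (u := u) _ _ _ vw).
  + move=> x vx /and4P[xw xt xq vxA].
    have xvA : (x, v) \in A.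
      have : (x, v) \in side_darts A by rewrite -side_darts_opp.
      rewrite (side_dartsE s) => /orP[//|xvF].
      by case: (injI _ _ xvF wv erefl) xw => ->; rewrite eqxx.
    have vrA : (v, rot v x) \in A := split_stepA s xvA.
    have xw' : rot v x != w by rewrite -e2 (inj_eq perm_inj).
    have xt' : rot v x != t v by rewrite et (inj_eq perm_inj).
    rewrite /P xw' xt' inE vrA /= andbT.
    apply: contraTneq vrA => ->.
    by have [/(split_FA s)] := setIdP pq.
  + by have := subsetP (side_darts_sub s) _ vu; rewrite inE.
  + by rewrite /P uw ut uq.
(* Now [t v] is the head [q] of the boundary dart and [v] the apex of its triangle, so
   [t (t v) = v]. *)
- by rewrite (tE p) // ?et -?ev //.
Qed.

Lemma inside_face_ge15 : 15 <= #|F|.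
Proof.
have [F14 _] := card_inside s AB; rewrite ltn_neqAle F14 andbT eq_sym.
by apply/eqP; apply: inside_face_neq14.
Qed.
End Inside.
End Extremal.

(** * Two shared vertices: the order in which the cut face is traversed *)

Section TwoCut.
Variable G : emap.
Local Notation dart := (vertex G * vertex G)%type.
Local Notation step := (@face_step G).
Implicit Types (d : dart) (S : {set dart}) (v : vertex G).

Section OneSide.
Variables F A B : {set dart}.
Hypothesis s : dual_split F A B.
Let s' := dual_split_sym s.
Let X := side_vertices A :&: side_vertices B.
Hypothesis small : #|boundary F A| <= 5.

(** A circulation passing twice through a vertex has at least six darts. *)
Lemma boundary_out_inj : {in boundary F A &, injective fst}.
Proof.
move=> d d' dA dA' /= e.
have := card_circulation2 (boundary_sub s) (boundary_opp s) (boundary_balanced s).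
move=> /(_ d.1) c; have : #|outs (boundary F A) d.1| <= 1.
  by rewrite leqNgt; apply/negP=> /c; lia.
by move/card_le1_eq; apply; rewrite inE ?dA ?dA' ?e /=.
Qed.

Lemma boundary_in_inj : {in boundary F A &, injective snd}.
Proof.
move=> d d' dA dA' /= e.
have := card_circulation2 (boundary_sub s) (boundary_opp s) (boundary_balanced s).
move=> /(_ d.2) c; have : #|ins (boundary F A) d.2| <= 1.
  by rewrite -(boundary_balanced s) leqNgt; apply/negP=> /c; lia.
by move/card_le1_eq; apply; rewrite inE ?dA ?dA' ?e /=.
Qed.

Lemma side_vertices_ends d : d \in side_darts A ->
  d.1 \in side_vertices A /\ d.2 \in side_vertices A.
Proof.
move=> dA; split; first by apply/imsetP; exists d.
by apply/imsetP; exists (opp d); rewrite ?side_darts_opp.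
Qed.

(** The cut face can pass from one side to the other only at a shared vertex. *)
Lemma step_inner d : d \in boundary F A -> d.2 \notin X -> step d \in boundary F A.
Proof.
move=> dA dX; have [dF _] := setIdP dA; have sF := split_stepF s dF.
have vA := (side_vertices_ends (boundary_side s dA)).2.
have : step d \in darts G by rewrite (split_cover s) sF.
case/(darts_cover s)/orP => [|sB].
  by rewrite (side_dartsE s) (negbTE (split_FA s sF)).
case/negP: dX; rewrite inE vA; apply/side_vertexP; exists (step d).2.
by rewrite /= in sB.
Qed.

(** [F] is a single cycle, and the predecessor of [d0] on it ends at the shared vertex [d0.1]. Hence
    a shared vertex is met eventually, and [j] is the first such time. *)
Lemma boundary_segment d0 : d0 \in boundary F A -> d0.1 \in X ->
  exists j, [/\ forall i, i <= j -> iter i step d0 \in boundary F A,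
    (iter j step d0).2 \in X & forall i, i < j -> (iter i step d0).2 \notin X].
Proof.
move=> dA dX; have [dF _] := setIdP dA.
have [d' dF' e] := step_onto (split_stepF s) dF.
have exj : exists j, (iter j step d0).2 \in X.
  exists (findex step d0 d'); rewrite iter_findex ?(split_orbit s) //.
  by move: dX; rewrite {1}e.
exists (ex_minn exj); case: ex_minnP => j jX jmin.
have jnX i : i < j -> (iter i step d0).2 \notin X.
  by move=> ij; apply: contraTN ij => /jmin; rewrite -leqNgt.
split=> //; elim=> [|i IH] ij //=; apply: step_inner; first exact/IH/ltnW.
exact: jnX.
Qed.

Lemma segment_tails d0 j x i : d0.1 != x -> x \in X ->
    (forall i, i < j -> (iter i step d0).2 \notin X) ->
  i <= j -> (iter i step d0).1 != x.
Proof.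
move=> d0x xX jnX; case: i => [//|i] ij /=.
by apply: contraTneq xX => <-; apply: jnX.
Qed.

(* A segment returning to its origin and the rest of the boundary would be two
   circulations, with at least three darts each. *)
Lemma segment_ends d0 j x :
    (forall i, i <= j -> iter i step d0 \in boundary F A) ->
    (forall i, i < j -> (iter i step d0).2 \notin X) ->
    x \in X -> d0.1 != x ->
  (iter j step d0).2 != d0.1.
Proof.
move=> jA jnX xX d0x; apply/eqP=> ej.
pose C := [set iter (i : 'I_j.+1) step d0 | i : 'I_j.+1].
have CP d : reflect (exists2 i, i <= j & d = iter i step d0) (d \in C).
  apply: (iffP imsetP) => [[i _ ->]|[i ij ->]]; first by exists i; first exact: (ltn_ord i).
  by exists (Ordinal (ij : i < j.+1)).
move: C CP => C CP.
have CA : C \subset boundary F A by apply/subsetP=> _ /CP[i ij ->]; apply: (jA i).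
have bG := subset_trans _ (boundary_sub s).
have brev S : S \subset boundary F A -> {in S, forall d, opp d \notin S}.
  move=> /subsetP SA d dS; apply: contra (boundary_opp s (SA _ dS)); exact: SA.
have c1 : 3 <= #|C|.
  apply: card_circulation (bG _ CA) _ (brev _ CA) _.
    by apply/set0Pn; exists d0; apply/CP; exists 0.
  move=> _ /CP[i ij ->]; have [ij'|ij'] := ltnP i j.
    by exists (iter i.+1 step d0) => //; apply/CP; exists i.+1.
  exists d0; first by apply/CP; exists 0.
  by have -> : i = j by lia.
have c2 : 3 <= #|boundary F A :\: C|.
  have sub := subsetDl (boundary F A) C.
  apply: card_circulation (bG _ sub) _ (brev _ sub) _.
    have [u xu] := shared_outA s xX; apply/set0Pn; exists (x, u); rewrite inE xu andbT.
    apply/CP=> -[i ij e]; have := segment_tails d0x xX jnX ij.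
    by rewrite -e eqxx.
  (* A dart outside [C] is not followed by one of [C]: each vertex is entered only once, so the dart
     would be the cyclic predecessor on the closed segment. *)
  move=> e /setDP[eA eC]; have [e' e'A ee'] := boundary_next s eA.
  exists e' => //; rewrite inE e'A andbT; apply: contraNN eC => /CP[[|i] ij ei].
    apply/CP; exists j => //; apply: boundary_in_inj => //; first exact: jA.
    by rewrite /= ej -ee' ei.
  apply/CP; exists i; first exact: ltnW.
  apply: boundary_in_inj => //; first exact/jA/ltnW.
  by rewrite -ee' ei.
have := cardsID C (boundary F A); rewrite (setIidPr CA) => e.
by have := leq_trans (leq_trans (leq_add c1 c2) (eq_leq e)) small.
Qed.
End OneSide.

Section Cross.
Variables F A B : {set dart}.
Hypothesis s : dual_split F A B.
Let s' := dual_split_sym s.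
Let X := side_vertices A :&: side_vertices B.
Hypothesis small : #|boundary F A| <= 5.

(** Otherwise [step d] is the only boundary dart of [A] leaving [d.2], and only from [d] does the
    facial walk continue along it. The rotation at [d.2], started on the side of [B], could then
    never leave that side, although it meets [d.1]. *)
Lemma step_cross d : d \in boundary F A -> d.2 \in X -> step d \in boundary F B.
Proof.
move=> dA dX; have [dF _] := setIdP dA; have sF := split_stepF s dF.
have : step d \in darts G by rewrite (split_cover s) sF.
case/(darts_cover s)/orP; last first.
  by rewrite (side_dartsE s') (negbTE (split_FB s sF)).
rewrite (side_dartsE s) (negbTE (split_FA s sF)) /= => sA.
have [u uv] := shared_inB s dX.
have vu : adj d.2 u by have := subsetP (boundary_sub s') _ uv; rewrite inE adj_sym.
have vd : adj d.2 d.1 by have := subsetP (boundary_sub s) _ dA; rewrite inE adj_sym.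
have : (d.1, d.2) \in side_darts B.
  apply: (rot_closed (P := fun x => (x, d.2) \in side_darts B) _ vu _ vd); last first.
    exact: (boundary_side s').
  move=> x vx xB; have [xb|xb] := boolP ((x, d.2) \in boundary F B); last first.
    exact: (side_rot s' xB).
  have [xF _] := setIdP xb; have rF := split_stepF s xF.
  have : step (x, d.2) \in darts G by rewrite (split_cover s) rF.
  rewrite -side_darts_opp; case/(darts_cover s)/orP => //.
  rewrite (side_dartsE s) (negbTE (split_FA s rF)) /= => rA.
  have /face_step_inj e := boundary_out_inj s small rA sA erefl.
  by case/setIdP: xb; case/setIdP: dA; rewrite e => _ /(split_AB s)/negP.
move=> dB; have := side_darts_disj s (boundary_side s dA).
by rewrite [d]surjective_pairing dB.
Qed.
End Cross.

Section Two.
Variables F A B : {set dart}.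
Hypothesis s : dual_split F A B.
Let s' := dual_split_sym s.
Let X := side_vertices A :&: side_vertices B.

(* If |F| <= 8, both boundaries are single cycles through the two shared
   vertices x and y.  Then F goes from x to y along A and back along B, and
   misses the other half of the boundary of A. *)
Lemma two_cut_face_ge9 : #|X| = 2 -> 9 <= #|F|.
Proof.
move=> X2; rewrite leqNgt; apply/negP=> F8.
have cF := card_face_split s; have a3 := boundary_ge3 s; have b3 := boundary_ge3 s'.
have a5 : #|boundary F A| <= 5.
  by move: F8; rewrite cF; move: a3 b3; move: #|_| #|_| => m n; lia.
have b5 : #|boundary F B| <= 5.
  by move: F8; rewrite cF; move: a3 b3; move: #|_| #|_| => m n; lia.
have eX : side_vertices B :&: side_vertices A = X by rewrite setIC.
have /cards2P[x [y [xy eXxy]]] : #|X| == 2 by apply/eqP.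
have xX : x \in X by rewrite eXxy !inE eqxx.
have yX : y \in X by rewrite eXxy !inE eqxx orbT.
have [u xu] := shared_outA s xX.
have [j [jA jX jnX]] := boundary_segment s xu xX.
have jy : (iter j step (x, u)).2 = y.
  have := segment_ends s a5 jA jnX yX xy.
  by move: jX; rewrite -/X eXxy !inE => /orP[->|/eqP].
have d1B := step_cross s a5 (jA _ (leqnn j)) jX.
set d1 := step _ in d1B.
have d1y : d1.1 = y by rewrite /= jy.
have d1X : d1.1 \in side_vertices B :&: side_vertices A by rewrite eX d1y.
have [k [kB kX knX]] := boundary_segment s' d1B d1X.
have kx : (iter k step d1).2 = x.
  have xX' : x \in side_vertices B :&: side_vertices A by rewrite eX.
  have := segment_ends s' b5 kB knX xX'; rewrite d1y eq_sym xy => /(_ isT).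
  by move: kX; rewrite eX eXxy !inE => /orP[/eqP|->].
have back : step (iter k step d1) = (x, u).
  have h := step_cross s' b5 (kB _ (leqnn k)) kX.
  exact: (boundary_out_inj s a5 h xu kx).
have [w yw] := shared_outA s yX.
(* [P] holds on the stretch from [x] to [y] along [A] and on the one back along [B]; by [back] it is
   closed under steps, hence holds on all of [F]. But the dart [(y, w)] facing [A] lies on neither
   stretch. *)
pose P d := (d \in traject step (x, u) j.+1) || (d \in traject step d1 k.+1).
have Pcl d d' : step d == d' -> P d -> P d'.
  move=> /eqP <- /orP[] /trajectP[i]; rewrite ltnS leq_eqVlt => /orP[/eqP->|lt] ->.
  - by apply/orP; right; apply/trajectP; exists 0.
  - by apply/orP; left; apply/trajectP; exists i.+1.
  - by rewrite back; apply/orP; left; apply/trajectP; exists 0.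
  - by apply/orP; right; apply/trajectP; exists i.+1.
have Pyw : P (y, w).
  have [xF _] := setIdP xu; have [yF _] := setIdP yw.
  apply: connect_ind Pcl (split_orbit s xF yF) _.
  by apply/orP; left; apply/trajectP; exists 0.
case/orP: Pyw => /trajectP[i ij e].
  by have := @segment_tails A B (x, u) j y i xy yX jnX ij; rewrite -e eqxx.
have : (y, w) \in boundary F B by rewrite e; apply: kB.
move=> /(boundary_side s')/(side_darts_disj s')/negP; apply.
exact: (boundary_side s).
Qed.
End Two.
End TwoCut.

(** With [n] shared vertices: [n = 1] uses [a] and [b] at least 3, [n = 2] is the special bound,
    [n = 3, 4, 5] give 9, 10, 10 by the quadratic inequality, and from 6 on [f >= 2n] suffices. *)
Lemma min1f_le c n a b f :
    0 < c -> f = a + b -> 3 <= a -> 3 <= b -> n <= a -> n <= b ->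
    8 * n <= f.*2 + n * n.-1 -> (n = 2 -> 9 <= f) -> c <= n ->
  min1f c <= f.
Proof.
case: c => [|[|[|[|[|[|[|[|c]]]]]]]] //= _; case: n => [|[|[|[|[|n]]]]] //=; lia.
Qed.

(** * From a cut-vertex of the dual to the lower bound on its size *)

Section Dual.
Variable G : emap.
Local Notation dart := (vertex G * vertex G)%type.
Local Notation step := (@face_step G).
Implicit Types (d : dart) (S : {set dart}) (v : vertex G).

Lemma mem_face d : d \in face d.
Proof. by rewrite inE connect0. Qed.

Lemma face_eq d d' : (face d == face d') = (d' \in face d).
Proof.
apply/eqP/idP => [->|]; first exact: mem_face.
rewrite inE => dd'; apply/setP=> x; rewrite !inE.
by rewrite (same_connect (fconnect_sym (@face_step_inj G)) dd').
Qed.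

Lemma face_step_eq d : face (step d) = face d.
Proof. by apply/eqP; rewrite eq_sym face_eq inE fconnect1. Qed.

Lemma mem_faces d : d \in darts G -> face d \in faces G.
Proof. by move=> dG; apply/imsetP; exists d. Qed.

Lemma ends_eq d d' :
  [set d.1; d.2] = [set d'.1; d'.2] -> d' = d \/ d' = opp d.
Proof.
case: d d' => u v [u' v'] /= e.
have : u' \in [set u; v] by rewrite e !inE eqxx.
have : v' \in [set u; v] by rewrite e !inE eqxx orbT.
have : u \in [set u'; v'] by rewrite -e !inE eqxx.
have : v \in [set u'; v'] by rewrite -e !inE eqxx orbT.
rewrite !inE => /orP[]/eqP e1 /orP[]/eqP e2 /orP[]/eqP e3 /orP[]/eqP e4; subst;
  by [left | right].
Qed.

Lemma dual_endsE d : d \in darts G ->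
  dual_ends [set d.1; d.2] = [set face d; face (opp d)].
Proof.
move=> dG; apply/setP=> f; rewrite in_set2; apply/imsetP/orP => [[d' + ->]|].
  rewrite inE => /andP[_ /eqP/esym/ends_eq[]->]; rewrite eqxx; by [left | right].
case=> /eqP->; [exists d | exists (opp d)] => //; rewrite inE ?opp_dart ?dG /=.
  by [].
by apply/eqP; rewrite setUC.
Qed.

Lemma mem_edges d : d \in darts G -> [set d.1; d.2] \in edges G.
Proof. by move=> dG; apply/imsetP; exists d. Qed.

Lemma dual_adj_opp d : d \in darts G -> dual_adj (face d) (face (opp d)).
Proof.
move=> dG; apply/exists_inP; exists [set d.1; d.2]; first exact: mem_edges.
by rewrite dual_endsE.
Qed.

Section Simple.
Hypothesis sG : simple_dual G.

Lemma simple_loopless d : d \in darts G -> opp d \notin face d.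
Proof.
move=> dG; have := sG.1 _ (mem_edges dG); rewrite dual_endsE // cards2 -face_eq.
by case: eqP.
Qed.

(** Both edges join the same two faces, so they coincide; with reversed direction, [d] and [opp d]
    would share a face. *)
Lemma simple_face_inj d d' : d \in darts G -> d' \in face d ->
  opp d' \in face (opp d) -> d' = d.
Proof.
move=> dG dd' oo'; have d'G : d' \in darts G.
  move: dd'; rewrite inE => /iter_findex <-.
  by elim: (findex _ _ _) => //= n; apply: step_dart.
have : [set d.1; d.2] = [set d'.1; d'.2].
  apply: sG.2; rewrite ?mem_edges // !dual_endsE //.
  by move: dd' oo'; rewrite -!face_eq => /eqP-> /eqP->.
case/ends_eq=> // e; have := simple_loopless dG.
by rewrite -e dd'.
Qed.

Section Cut.
Variables (F x y : {set dart}).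
Hypotheses (FG : F \in faces G) (xF : x \in faces G :\ F) (yF : y \in faces G :\ F).
Let linked := connect [rel u v | [&& u \in faces G :\ F, v \in faces G :\ F & dual_adj u v]].
Hypothesis nxy : ~~ linked x y.

(** The first side is the component of [x] in the dual without [F], the second consists of all other
    components and contains [y]. *)
Lemma disconnected_split :
  dual_split F [set d in darts G | (face d != F) && linked x (face d)]
               [set d in darts G | (face d != F) && ~~ linked x (face d)].
Proof.
have [d0 d0G eF] := imsetP FG.
have inF d : (d \in F) = (face d == F) by rewrite eF eq_sym face_eq.
have FD d : d \in F -> d \in darts G.
  rewrite eF inE => /iter_findex <-.
  by elim: (findex _ _ _) => //= n; apply: step_dart.
split.
- move=> d; rewrite !inE; case: (boolP (d \in F)) => [/FD|]; first by rewrite inE.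
  by rewrite inF => -> /=; rewrite -andb_orr orbN andbT.
- by move=> d; rewrite inF inE => ->; rewrite andbF.
- by move=> d; rewrite inF inE => ->; rewrite andbF.
- by move=> d; rewrite !inE => /and3P[_ _ ->]; rewrite !andbF.
- move=> d d'; rewrite eF !inE => dd dd'.
  by rewrite -(same_connect (fconnect_sym (@face_step_inj G)) dd).
- by move=> d; rewrite !inF face_step_eq.
- by move=> d /setIdP[dG ?]; rewrite inE step_dart // face_step_eq.
- by move=> d /setIdP[dG ?]; rewrite inE step_dart // face_step_eq.
- move=> d dF; have := simple_loopless (FD _ dF); rewrite -face_eq inF => ne.
  by apply: contraNN ne => /eqP->; rewrite -inF.
- move=> d /setIdP[dG /andP[dF xd]]; rewrite inE !negb_and !negbK; apply/orP; right.
  case: (boolP (face (opp d) == F)) => //= oF.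
  apply: connect_trans xd (connect1 _) => /=.
  rewrite !in_setD1 dF oF !mem_faces ?opp_dart //=; exact: dual_adj_opp.
- move=> d d' dF dF' oo'; apply/esym/simple_face_inj; rewrite ?FD //.
    by rewrite -face_eq; move: dF dF'; rewrite !inF => /eqP-> /eqP->.
  by rewrite inE.
- move: xF; rewrite in_setD1 => /andP[xnF /imsetP[d dG xd]]; apply/set0Pn; exists d.
  by rewrite inE dG -xd xnF; apply: connect0.
- move: yF; rewrite in_setD1 => /andP[ynF /imsetP[d dG yd]]; apply/set0Pn; exists d.
  by rewrite inE dG -yd ynF.
Qed.
End Cut.

(** The face of [d] has at least three darts, and the faces across them are distinct because
    parallel dual edges are excluded. *)
Lemma card_faces_gt2 d : d \in darts G -> 2 < #|faces G|.
Proof.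
move=> dG; have d1G := step_dart dG; have d2G := step_dart d1G.
have ne2 : step (step d) != d.
  apply: contraNneq (simple_loopless dG) => e.
  suff -> : opp d = step d by rewrite inE fconnect1.
  by case: d e {dG d1G d2G} => u v [/= e _]; rewrite /face_step /= e.
have nf a b : a \in darts G -> b \in face a -> b != a -> face (opp a) != face (opp b).
  move=> aG ba; apply: contraNN; rewrite face_eq => ob.
  by rewrite (simple_face_inj aG ba ob).
have n1 := nf d (step d) dG _ (step_neq dG).
have n2 := nf d (step (step d)) dG _ ne2.
have n3 := nf _ (step (step d)) d1G _ (step_neq d1G).
have : uniq [:: face (opp d); face (opp (step d)); face (opp (step (step d)))].
  rewrite /= !inE negb_or n1 ?n2 ?n3 // inE ?fconnect1 //.
  exact: (fconnect_iter _ 2).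
move/card_uniqP => /= <-; apply: subset_leq_card; apply/subsetP=> f.
by rewrite !inE => /or3P[] /eqP->; apply: mem_faces; rewrite opp_dart.
Qed.
End Simple.

Lemma exists_dart : 1 < #|vertex G| -> exists d, d \in darts G.
Proof.
case/card_gt1P=> u [w [_ _ uw]].
have /connectP[[|z p]] := @adj_connected G u w (in_setT _) (in_setT _).
  by move=> _ e; rewrite e eqxx in uw.
by move=> /= /andP[/and3P[_ _ uz] _] _; exists (u, z); rewrite inE.
Qed.

(** If one side has only shared vertices, the bound 15 applies. Otherwise the shared vertices
    separate the map, so there are at least [c] of them. *)
Lemma split_face_ge c (F A B : {set dart}) : 1 <= c -> k_connected (@adj G) c [set: vertex G] ->
  dual_split F A B -> min1f c <= #|F|.
Proof.
move=> c1 [_ con] s; have s' := dual_split_sym s.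
have small : min1f c <= 15 by case: c {c1 con} => [|[|[|[|[|[|[|[|c]]]]]]]].
have [AB|nAB] := boolP (side_vertices A \subset side_vertices B).
  exact: leq_trans small (inside_face_ge15 s AB).
have [BA|nBA] := boolP (side_vertices B \subset side_vertices A).
  exact: leq_trans small (inside_face_ge15 s' BA).
have [u uA uB] := subsetPn nAB; have [w wB wA] := subsetPn nBA.
set X := side_vertices A :&: side_vertices B.
have cX : c <= #|X|.
  rewrite leqNgt; apply/negP=> Xc; have conX := con X (subsetT _) Xc.
  by apply: (split_separates s conX (subxx _) uA _ wB); rewrite inE ?(negbTE uB) ?(negbTE wA) ?andbF.
have cF := card_face_split s; have a3 := boundary_ge3 s; have b3 := boundary_ge3 s'.
have aX := boundary_ge_shared s; have bX := boundary_ge_shared s'; rewrite setIC in bX.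
have wX := face_bound_within s; have two := two_cut_face_ge9 s.
rewrite -/X in aX bX wX two.
exact: (min1f_le c1 cF a3 b3 aX bX wX two cX).
Qed.
End Dual.

Lemma dual_2connected (c : nat) (G : emap) : 1 <= c ->
    k_connected (@adj G) c [set: vertex G] -> simple_dual G ->
    (forall F, F \in faces G -> #|F| < min1f c) ->
  k_connected (@dual_adj G) 2 (faces G).
Proof.
move=> c1 con sG small.
have [d dG] : exists d, d \in darts G.
  apply: exists_dart; have [cV _] := con; rewrite cardsT in cV.
  exact: leq_ltn_trans c1 cV.
have f3 := card_faces_gt2 sG dG; split=> // S SG S2.
have cut F : F \in faces G -> connected_on (@dual_adj G) (faces G :\ F).
  move=> FG x y xF yF; apply/negPn/negP=> nxy.
  have := split_face_ge c1 con (disconnected_split sG FG xF yF nxy).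
  by rewrite leqNgt small.
have [/eqP|] := posnP #|S|; last first.
  move=> S1; have /cards1P[F SF] : #|S| == 1 by rewrite eqn_leq S1 -ltnS S2.
  by rewrite SF; apply: cut; apply: (subsetP SG); rewrite SF set11.
rewrite cards_eq0 => /eqP-> x y; rewrite setD0 => xG yG.
(* For empty [S], two faces are linked already in the dual without some third face [z]. *)
have [z] : exists z, z \in faces G :\ x :\ y.
  apply/set0Pn; rewrite -card_gt0; move: f3.
  rewrite (cardsD1 x) (cardsD1 y (_ :\ x)).
  by do 2!case: (_ \in _) => /=; rewrite ?add1n ?add0n // => /ltnW // /ltnW.
rewrite !in_setD1 => /and3P[zy zx zG].
have /cut/(_ x y) := zG; rewrite !in_setD1 xG yG eq_sym zx eq_sym zy.
move=> /(_ isT isT); apply: connect_sub => a b /and3P[].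
rewrite !in_setD1 => /andP[_ aG] /andP[_ bG] ab; apply: connect1.
by rewrite /= aG bG.
Qed.

(** * Maps with one large face *)

Section RotationSystem.
Variables (T : finType) (e : rel T) (r : T -> T -> T).
Hypotheses (e_sym : symmetric e) (e_irr : irreflexive e) (T_gt0 : 0 < #|T|).
Hypotheses (e_con : connected_on e [set: T]) (r_inj : forall v, injective (r v)).
Hypothesis r_out : forall v u, ~~ e v u -> r v u = u.
Hypothesis r_cyc : forall v u w, e v u -> fconnect (r v) u w = e v w.

Lemma rotation_on v : perm_on [set u | e v u] (perm (@r_inj v)).
Proof.
by apply/subsetP=> u; rewrite !inE permE; apply: contraR => /r_out ->.
Qed.

Lemma rotation_cyclic v u : e v u -> porbit (perm (@r_inj v)) u = [set w | e v w].
Proof.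
move=> vu; apply/setP=> w; rewrite inE -(r_cyc w vu).
have it i : (perm (@r_inj v) ^+ i)%g u = iter i (r v) u.
  by rewrite permX; apply: eq_iter => x; rewrite permE.
apply/porbitP/idP => [[i ->]|uw]; first by rewrite it fconnect_iter.
by exists (findex (r v) u w); rewrite it iter_findex.
Qed.

Definition emap_of : emap :=
  EMap e_sym e_irr T_gt0 e_con rotation_on rotation_cyclic.

Lemma face_step_of (d : T * T) : face_step (G := emap_of) d = (d.2, r d.2 d.1).
Proof. by rewrite /face_step /= permE. Qed.
End RotationSystem.

Section CyclicReach.
Variables (T : finType) (f : T -> T) (N : pred T) (x0 y0 : T).
Hypotheses (fN : forall u, N u -> N (f u)) (fout : forall u, ~~ N u -> f u = u).
Hypotheses (Ny : N y0) (fy : f y0 = x0) (reach : forall u, N u -> fconnect f x0 u).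

Lemma reach_iter i : N (iter i f x0).
Proof. by elim: i => [|i IH] /=; [rewrite -fy; apply: fN | apply: fN]. Qed.

(** Every element of [N] is an iterate of [x0], and [x0] itself is the image of [y0]; so [f] maps
    the finite set [N] onto itself. Explicit rotations thus need no inverse. *)
Lemma reach_inj : injective f.
Proof.
have injN : {in [set u | N u] &, injective f}.
  apply/imset_injP; rewrite eqn_leq leq_imset_card; apply: subset_leq_card.
  apply/subsetP=> u; rewrite inE => /reach/iter_findex <-.
  case: (findex f x0 u) => [|i] /=; first by rewrite -fy imset_f // inE.
  by rewrite imset_f // inE reach_iter.
move=> u w; have [Nu|Nu] := boolP (N u); have [Nw|Nw] := boolP (N w).
- by apply: injN; rewrite inE.
- by rewrite (fout Nw) => e; move: Nw; rewrite -e fN.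
- by rewrite (fout Nu) => e; move: Nu; rewrite e fN.
- by rewrite !fout.
Qed.

Lemma reach_cyc u w : N u -> fconnect f u w = N w.
Proof.
move=> Nu; rewrite -(same_connect (fconnect_sym reach_inj) (reach Nu)).
by apply/idP/idP=> [/iter_findex <-|/reach //]; apply: reach_iter.
Qed.
End CyclicReach.

(** * Connectivity through a set of hubs *)

Section Hubs.
Variables (T : finType) (e : rel T).
Hypothesis e_sym : symmetric e.

Lemma k_connected_leq c c' A : c <= c' -> k_connected e c' A -> k_connected e c A.
Proof.
move=> cc' [cA con]; split=> [|S SA Sc]; first exact: leq_ltn_trans cA.
by apply: con => //; apply: leq_trans cc'.
Qed.

(* After the removal of fewer than c vertices, the remaining hubs are still
   linked, and every other vertex is still linked to a hub. *)
Lemma hub_k_connected c (K : {set T}) :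
    0 < c -> c < #|T| ->
    {in K &, forall u v, [|| u == v, e u v | c <= #|[set w | e u w & e w v]|]} ->
    (forall v, v \notin K -> c <= #|[set w in K | e v w]|) ->
  k_connected e c [set: T].
Proof.
move=> c0 cT KK Kout; split=> [|S _ Sc]; first by rewrite cardsT.
pose g := [rel u v | [&& u \in setT :\: S, v \in setT :\: S & e u v]].
have gS u v : u \notin S -> v \notin S -> e u v -> connect g u v.
  by move=> uS vS uv; apply: connect1; rewrite /= !inE uS vS.
have gK : {in K &, forall u v, u \notin S -> v \notin S -> connect g u v}.
  move=> u v uK vK uS vS; case/or3P: (KK u v uK vK) => [/eqP->|uv|cuv].
  - exact: connect0.
  - exact: gS.
  have [w wuv wS] : exists2 w, w \in [set w | e u w & e w v] & w \notin S.
    apply/subsetPn; apply: contraTN cuv => /subset_leq_card le.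
    by rewrite -ltnNge (leq_ltn_trans le).
  move: wuv; rewrite inE => /andP[uw wv].
  exact: connect_trans (gS _ _ uS wS uw) (gS _ _ wS vS wv).
have toK u : u \notin S -> exists w, [/\ w \in K, w \notin S, connect g u w & connect g w u].
  move=> uS; have [uK|uK] := boolP (u \in K); first by exists u.
  have [w wuv wS] : exists2 w, w \in [set w in K | e u w] & w \notin S.
    apply/subsetPn; apply: contraTN (Kout u uK) => /subset_leq_card le.
    by rewrite -ltnNge (leq_ltn_trans le).
  move: wuv; rewrite inE => /andP[wK uw]; exists w; split=> //; apply: gS => //.
  by rewrite e_sym.
move=> u v; rewrite !inE !andbT => uS vS.
have [u' [uK uS' uu' _]] := toK u uS; have [v' [vK vS' _ vv']] := toK v vS.
exact: connect_trans uu' (connect_trans (gK _ _ uK vK uS' vS') vv').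
Qed.

Lemma k_connected_connected c : 0 < c -> k_connected e c [set: T] -> connected_on e [set: T].
Proof. by move=> c0 [_ /(_ set0)]; rewrite setD0 cards0; apply; rewrite ?sub0set. Qed.
End Hubs.

Definition one_big_face_map (c f : nat) : Prop := exists G : emap,
  [/\ k_connected (@adj G) c [set: vertex G],
      exists2 F, F \in faces G &
        #|F| = f /\ (forall F', F' \in faces G -> F' != F -> #|F'| = 3),
      simple_dual G & has_1cut (@dual_adj G) (faces G)].

(** * A criterion for a map with one large face that is a cut-vertex of the dual *)

Section OneBigFace.
Variable G : emap.
Local Notation dart := (vertex G * vertex G)%type.
Local Notation step := (@face_step G).
Variables (L : seq dart) (side : dart -> bool) (d0 dA dB : dart).
Hypotheses (LG : {subset L <= darts G}) (L_uniq : uniq L) (L_cycle : fcycle step L).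
Hypothesis L_d0 : d0 \in L.
Hypothesis triangles : forall d, d \in darts G -> d \notin L -> step (step (step d)) = d.
Hypothesis apex_neq : forall d, d \in darts G -> d \notin L -> opp d \notin L ->
  (step d).2 != (step (opp d)).2.
Hypothesis L_opp : forall d, d \in L -> opp d \notin L.
Hypothesis L_simple : forall d, d \in L ->
  opp (step (opp d)) \notin L /\ opp (step (step (opp d))) \notin L.
Hypothesis side_opp : forall d, d \in darts G -> side (opp d) = side d.
Hypothesis side_step : forall d, d \in darts G -> d \notin L -> side (step d) = side d.
Hypotheses (dAG : dA \in darts G) (dAL : dA \notin L) (sA : side dA).
Hypotheses (dBG : dB \in darts G) (dBL : dB \notin L) (sB : ~~ side dB).

Lemma big_faceE d : d \in L -> face d = [set x in L].
Proof.
by move=> dL; apply/setP=> x; rewrite !inE (fconnect_cycle L_cycle dL).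
Qed.

Lemma mem_big_face d : (d \in face d0) = (d \in L).
Proof. by rewrite big_faceE // inE. Qed.

Lemma face_bigP d : (face d == face d0) = (d \in L).
Proof. by rewrite eq_sym face_eq mem_big_face. Qed.

Lemma small_face_uniq d : d \in darts G -> d \notin L ->
  uniq [:: d; step d; step (step d)].
Proof.
move=> dG dL; have n1 := step_neq dG; have n2 := step_neq (step_dart dG).
have n3 : step (step d) != d.
  by apply: contraNneq n1 => e; have := triangles dG dL; rewrite e => ->.
have u3 (x y z : dart) : y != x -> z != y -> z != x -> uniq [:: x; y; z].
  by rewrite /= !inE !negb_or !(eq_sym z) (eq_sym y) => -> -> ->.
exact: u3.
Qed.

Lemma small_faceE d x : d \in darts G -> d \notin L ->
  (x \in face d) = (x \in [:: d; step d; step (step d)]).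
Proof.
move=> dG dL; rewrite inE; apply: fconnect_cycle; last by rewrite inE eqxx.
by apply/and4P; split=> //=; apply/eqP; exact: triangles.
Qed.

Lemma small_face_card d : d \in darts G -> d \notin L -> #|face d| = 3.
Proof.
move=> dG dL; transitivity #|[:: d; step d; step (step d)]|; last first.
  exact: (card_uniqP (small_face_uniq dG dL)).
by apply: eq_card => x; apply: small_faceE.
Qed.

Lemma face_loopless d : d \in darts G -> opp d \notin face d.
Proof.
move=> dG; have [dL|dL] := boolP (d \in L).
  by rewrite big_faceE // inE L_opp.
have d1G := step_dart dG; have d2G := step_dart d1G.
have := triangles dG dL; rewrite small_faceE //.
move: dG d1G d2G; case: d dL => u v _; rewrite /opp /face_step !inE /= !xpair_eqE.
move=> uv vw wx [exu ev].
apply/negP=> /or3P[] /andP[/eqP e1 /eqP e2].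
- by rewrite e1 adj_irr in uv.
- by rewrite exu -e2 adj_irr in wx.
- by rewrite -e1 adj_irr in vw.
Qed.

(** By [L_simple], no triangle meets the large face in two edges. Two triangles with two common
    edges would have equal apexes across either of them, against [apex_neq]. *)
Lemma simple_step d1 d2 : d1 \in darts G -> d2 \in darts G ->
  face d1 = face d2 -> face (opp d1) = face (opp d2) -> d1 = d2.
Proof.
have big d d' : d \in darts G -> d' \in darts G -> d \in L ->
    face d = face d' -> face (opp d) = face (opp d') -> d = d'.
  move=> dG d'G dL /eqP; rewrite face_eq big_faceE // inE => dL' /eqP.
  have oG : opp d \in darts G by rewrite opp_dart.
  rewrite face_eq small_faceE ?L_opp // !inE => /or3P[] /eqP e.
  - by apply: opp_inj.
  - by have [] := L_simple dL; rewrite -e oppK dL'.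
  - by have [_] := L_simple dL; rewrite -e oppK dL'.
move=> dG d'G; have [dL|dL] := boolP (d1 \in L); first exact: big.
have oG : opp d1 \in darts G by rewrite opp_dart.
have o'G : opp d2 \in darts G by rewrite opp_dart.
have [oL|oL] := boolP (opp d1 \in L).
  by move=> f f'; apply: opp_inj; apply: big; rewrite ?oppK.
move=> /eqP + /eqP; rewrite !face_eq !small_faceE //.
have ap := apex_neq dG dL oL.
have ns : step d1 != opp d1.
  by apply: contraNneq (face_loopless dG) => <-; rewrite inE fconnect1.
have := triangles oG oL; have := triangles dG dL.
have := step_dart oG; have := step_dart dG; move: dG d'G ap ns.
case: d1 {dL oL oG o'G} => u v; case: d2 => u' v'; rewrite /opp /face_step !inE /= !xpair_eqE.
move=> uv u'v' wx ns vw ux [-> e1] [-> e2].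
case/or3P=> /andP[/eqP-> /eqP->] //; case/or3P=> /andP[/eqP f1 /eqP f2].
- by rewrite f1 adj_irr in vw.
- by move: ns; rewrite f1 !eqxx.
- by rewrite f1 eqxx in wx.
- by rewrite f1 adj_irr in uv.
- by rewrite f2 eqxx in wx.
- by rewrite -f1 adj_irr in ux.
Qed.

Lemma big_face_simple_dual : simple_dual G.
Proof.
split=> [_ /imsetP[d dG ->]|_ _ /imsetP[d dG ->] /imsetP[d' d'G ->]].
  by rewrite dual_endsE // cards2 face_eq face_loopless.
rewrite !dual_endsE // => e.
have := set2P (_ : face d \in [set face d'; face (opp d')]).
rewrite -e set21 => /(_ isT) [] f.
  have f' : face (opp d) = face (opp d').
    have : face (opp d') \in [set face d; face (opp d)] by rewrite e set22.
    rewrite in_set2 f => /orP[/eqP fo|/eqP //].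
    by have := face_loopless d'G; rewrite -face_eq fo eqxx.
  by rewrite (simple_step dG d'G f f').
have o'G : opp d' \in darts G by rewrite opp_dart.
have f' : face (opp d) = face (opp (opp d')).
  have : face (opp d) \in [set face d'; face (opp d')] by rewrite -e set22.
  rewrite in_set2 -f oppK => /orP[/eqP //|/eqP fo].
  by have := face_loopless dG; rewrite -face_eq fo eqxx.
by rewrite (simple_step dG o'G f f') /= setUC.
Qed.

Lemma side_face d x : d \in darts G -> d \notin L -> x \in face d -> side x = side d.
Proof.
move=> dG dL; rewrite inE => /iter_findex <-; elim: (findex _ _ _) => //= i IH.
have iG : iter i step d \in darts G by elim: i {IH} => //= i; apply: step_dart.
have iL : iter i step d \notin L.
  rewrite -face_bigP; have /eqP <- : face d == face (iter i step d).
    by rewrite face_eq inE fconnect_iter.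
  by rewrite face_bigP.
by rewrite side_step.
Qed.

(** [side] is constant on each triangle and on each edge, so a dual path avoiding the large face
    never changes its value; [dA] and [dB] have different values. *)
Lemma big_face_1cut : has_1cut (@dual_adj G) (faces G).
Proof.
exists (face d0); first exact/mem_faces/LG.
move=> /(_ (face dA) (face dB)); rewrite !in_setD1 !face_bigP dAL dBL !mem_faces //.
move=> /(_ isT isT) conn.
pose P (f : {set dart}) := [forall d in f, side d].
have : P (face dB); last first.
  by move=> /forall_inP/(_ dB (mem_face _)); rewrite (negbTE sB).
have : P (face dA) by apply/forall_inP=> d /(side_face dAG dAL) ->.
apply: connect_ind conn.
move=> f f' /= /and3P[]; rewrite !in_setD1 => /andP[fF fG] /andP[f'F f'G].
case/exists_inP=> _ /imsetP[d dG ->] /eqP; rewrite dual_endsE // => ends /forall_inP fs.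
have key x : x \in darts G -> face x = f -> face (opp x) = f' -> [forall d in f', side d].
  move=> xG xf xf'; have xs : side x by apply: fs; rewrite -xf mem_face.
  have oG : opp x \in darts G by rewrite opp_dart.
  apply/forall_inP=> y; rewrite -xf' => /side_face-> //; first by rewrite side_opp.
  by rewrite -face_bigP xf'.
have : f \in [set face d; face (opp d)] by rewrite ends set21.
have : f' \in [set face d; face (opp d)] by rewrite ends set22.
rewrite !inE => /orP[]/eqP e' /orP[]/eqP e.
- apply/forall_inP=> y; rewrite e' -e; exact: fs.
- by apply: (key (opp d)); rewrite ?oppK ?opp_dart.
- exact: (key d).
- apply/forall_inP=> y; rewrite e' -e; exact: fs.
Qed.

Lemma one_big_face :
  [/\ exists2 F, F \in faces G &
        #|F| = size L /\ (forall F', F' \in faces G -> F' != F -> #|F'| = 3),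
      simple_dual G & has_1cut (@dual_adj G) (faces G)].
Proof.
split; [|exact: big_face_simple_dual|exact: big_face_1cut].
exists (face d0); first exact/mem_faces/LG.
split; first by rewrite big_faceE // cardsE; apply/card_uniqP.
by move=> _ /imsetP[d dG ->]; rewrite face_bigP; apply: small_face_card.
Qed.
End OneBigFace.

(** * Small maps given by tables *)

Section Tables.
Variables (tab : seq (seq nat)) (c m p : nat) (t0 : nat * nat) (hubs : seq nat).

(* Row v of the table lists the neighbours of v in their cyclic order around v. *)
Definition row v := nth [::] tab v.
Definition tdarts := [seq (u, v) | u <- iota 0 (size tab), v <- row u].
Definition topp (d : nat * nat) := (d.2, d.1).
Definition tstep (d : nat * nat) := (d.2, next (row d.2) d.1).
Definition tbig := traject tstep t0 m.
(* In all the tables used, the side A is a cone with apex p over its boundary. *)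
Definition tside d := p \in [:: d.1; d.2; (tstep d).2; (tstep (topp d)).2].

(** The tests that follow restate, as booleans on natural numbers, the hypotheses of [one_big_face]
    and [hub_k_connected], so that a concrete table is checked by evaluation. *)
Definition rows_ok := all (fun r => uniq r && all (gtn (size tab)) r) tab.
Definition simple_ok := all (fun d => (d.1 != d.2) && (topp d \in tdarts)) tdarts.
Definition big_ok :=
  [&& 0 < m, uniq tbig, iter m tstep t0 == t0, all (mem tdarts) tbig &
      all (fun d => [&& topp d \notin tbig, topp (tstep (topp d)) \notin tbig &
                        topp (tstep (tstep (topp d))) \notin tbig]) tbig].
Definition triangles_ok := all (fun d =>
  [&& (d \in tbig) || ((tstep (tstep (tstep d)) == d) && (tside (tstep d) == tside d)),
      [|| d \in tbig, topp d \in tbig | (tstep d).2 != (tstep (topp d)).2] &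
      tside (topp d) == tside d]) tdarts.
Definition sides_ok := has (fun d => (d \notin tbig) && tside d) tdarts
                    && has (fun d => (d \notin tbig) && ~~ tside d) tdarts.
Definition hubs_ok :=
  [&& 0 < c < size tab,
      all (fun u => all (fun v => [|| u == v, v \in row u |
         c <= count (fun w => (w \in row u) && (v \in row w)) (iota 0 (size tab))]) hubs) hubs &
      all (fun v => (v \in hubs) ||
         (c <= count (fun w => (w \in hubs) && (w \in row v)) (iota 0 (size tab)))) (iota 0 (size tab))].
Definition table_ok :=
  [&& rows_ok, simple_ok, big_ok, triangles_ok, sides_ok & hubs_ok].

Hypothesis ok : table_ok.

Let rows : rows_ok. Proof. by case/and5P: ok. Qed.
Let simple : simple_ok. Proof. by case/and5P: ok. Qed.
Let big : big_ok. Proof. by case/and5P: ok. Qed.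
Let tris : triangles_ok. Proof. by case/and5P: ok. Qed.
Let sides : sides_ok. Proof. by case/and5P: ok => _ _ _ _ /andP[]. Qed.
Let hubsP : hubs_ok. Proof. by case/and5P: ok => _ _ _ _ /andP[]. Qed.

Local Notation n := (size tab).-1.
Local Notation T := 'I_n.+1.

Let n1 : n.+1 = size tab.
Proof. by rewrite prednK //; case/and3P: hubsP => /andP[c0 cn] _ _; apply: ltn_trans cn. Qed.

Let mem_iotaT k : (k \in iota 0 (size tab)) = (k < n.+1).
Proof. by rewrite mem_iota add0n n1. Qed.

Let rowP v : uniq (row v) /\ forall u, u \in row v -> u < n.+1.
Proof.
have [vn|vn] := ltnP v (size tab); last by rewrite /row nth_default.
have /allP/(_ (row v)) := rows; rewrite mem_nth // => /(_ isT) /andP[? /allP lt].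
by split=> // u /lt; rewrite n1.
Qed.

Definition nbr (v : T) : seq T := map inord (row v).
Definition tadj : rel T := fun u v => (v : nat) \in row u.
Definition trot (v u : T) : T := next (nbr v) u.

Lemma val_nbr v : map val (nbr v) = row v.
Proof.
rewrite /nbr -map_comp map_id_in // => u /(rowP v).2 un /=; exact: inordK.
Qed.

Lemma mem_nbr v u : (u \in nbr v) = tadj v u.
Proof. by rewrite -(mem_map val_inj) val_nbr. Qed.

Lemma nbr_uniq v : uniq (nbr v).
Proof. by rewrite -(map_inj_uniq val_inj) val_nbr (rowP v).1. Qed.

Lemma val_trot v u : trot v u = next (row v) u :> nat.
Proof. by rewrite -val_nbr (next_map val_inj) ?nbr_uniq. Qed.

Definition tval (d : T * T) : nat * nat := (val d.1, val d.2).

Lemma tval_inj : injective tval.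
Proof. by case=> u v [u' v'] [/val_inj -> /val_inj ->]. Qed.

Lemma mem_tdarts d : (tval d \in tdarts) = tadj d.1 d.2.
Proof.
case: d => u v; apply/allpairsPdep/idP => [[x [y [_ yx [ex ey]]]]|uv].
  by rewrite -ex -ey in yx.
by exists (val u), (val v); split=> //; rewrite mem_iotaT ltn_ord.
Qed.

Lemma tadj_sym : symmetric tadj.
Proof.
suff i u v : tadj u v -> tadj v u by move=> u v; apply/idP/idP; apply: i.
rewrite -(mem_tdarts (u, v)) => uv.
by have /allP/(_ _ uv)/andP[_] := simple; rewrite -(mem_tdarts (v, u)).
Qed.

Lemma tadj_irr : irreflexive tadj.
Proof.
move=> u; apply/negP; rewrite -(mem_tdarts (u, u)) => uu.
by have /allP/(_ _ uu) := simple; rewrite eqxx.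
Qed.

Lemma trot_inj v : injective (trot v).
Proof. exact: can_inj (prev_next (nbr_uniq v)). Qed.

Lemma trot_out v u : ~~ tadj v u -> trot v u = u.
Proof. by rewrite -mem_nbr /trot next_nth => /negbTE ->. Qed.

Lemma trot_cyc v u w : tadj v u -> fconnect (trot v) u w = tadj v w.
Proof.
rewrite -!mem_nbr => vu; apply: fconnect_cycle vu w; exact: cycle_next (nbr_uniq v).
Qed.

Lemma card_count (P : pred nat) : #|[set w : T | P w]| = count P (iota 0 (size tab)).
Proof.
rewrite -sum1_card -sum1_count -[X in iota 0 X]n1 -[X in iota 0 X]subn0 -[iota _ _]/(index_iota _ _) big_mkord.
by apply: eq_bigl => w; rewrite inE.
Qed.

Lemma tadj_k_connected : k_connected tadj c [set: T].
Proof.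
have /and3P[/andP[c0 cn] /allP HH /allP Hout] := hubsP.
apply: (hub_k_connected tadj_sym (K := [set v : T | (v : nat) \in hubs])) => //.
- by rewrite card_ord n1.
- move=> u v; rewrite !inE => uH vH; have /allP/(_ _ vH) := HH _ uH.
  by rewrite -(card_count (fun w => (w \in row u) && ((v : nat) \in row w))).
- move=> v; rewrite inE => vH; have := Hout v.
  rewrite mem_iotaT ltn_ord => /(_ isT); rewrite (negbTE vH) /=.
  rewrite -(card_count (fun w => (w \in hubs) && (w \in row v))).
  by move=> h; apply: leq_trans h _; apply: eq_leq; apply: eq_card => w; rewrite !inE.
Qed.

Lemma tadj_connected : connected_on tadj [set: T].
Proof.
by apply: k_connected_connected tadj_k_connected; case/and3P: hubsP => /andP[].
Qed.

Lemma T_gt0 : 0 < #|T|. Proof. by rewrite card_ord. Qed.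

Definition tmap : emap :=
  emap_of tadj_sym tadj_irr T_gt0 tadj_connected trot_inj trot_out trot_cyc.

Let step := @face_step tmap.

Lemma tval_step (d : T * T) : tval (step d) = tstep (tval d).
Proof. by rewrite /step face_step_of /tval /tstep /= val_trot. Qed.

Lemma tval_opp (d : T * T) : tval (@opp tmap d) = topp (tval d).
Proof. by []. Qed.

Lemma mem_darts_tmap (d : T * T) : (d \in darts tmap) = (tval d \in tdarts).
Proof. by rewrite inE mem_tdarts. Qed.

(** The tests are transferred along the injection [tval], which commutes with face steps and
    reversal. *)
Lemma table_one_big_face_map : one_big_face_map c m.
Proof.
have /and5P[m0 Lu /eqP Lc /allP LG /allP Lo] := big.
have t0L : t0 \in tbig by rewrite /tbig -(prednK m0) /= inE eqxx.
have [d0 ed0] : exists d0 : T * T, tval d0 = t0.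
  have /allpairsPdep[x [y [xn yx ->]]] := LG _ t0L.
  rewrite mem_iotaT in xn; have yn := (rowP x).2 _ yx.
  by exists (Ordinal xn, Ordinal yn).
pose L := traject step d0 m.
have it i : tval (iter i step d0) = iter i tstep t0.
  by elim: i => //= i IH; rewrite tval_step IH.
have eL : map tval L = tbig.
  rewrite /L /tbig -ed0; elim: (m) (d0) => //= k IH d.
  by rewrite IH tval_step.
have memL d : (d \in L) = (tval d \in tbig) by rewrite -eL (mem_map tval_inj).
have find P : has P tdarts -> exists2 d : T * T, tval d \in tdarts & P (tval d).
  case/hasP=> _ /allpairsPdep[x [y [xn yx ->]]] Px.
  rewrite mem_iotaT in xn; have yn := (rowP x).2 _ yx.
  exists (Ordinal xn, Ordinal yn) => //.
  by apply/allpairsPdep; exists x, y; rewrite mem_iotaT.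
have /andP[/find[dA dAG /andP[dAL sA]] /find[dB dBG /andP[dBL sB]]] := sides.
have triP d := allP tris (tval d).
have h1 : {subset L <= darts tmap}.
  by move=> d; rewrite memL mem_darts_tmap => /LG.
have h2 : uniq L by rewrite -(map_inj_uniq tval_inj) eL.
have h3 : fcycle step L.
  have e : iter m.-1 step (step d0) = d0.
    by rewrite -iterSr prednK //; apply: tval_inj; rewrite it Lc.
  by rewrite /L -(prednK m0) /= -[X in rcons _ X]e -trajectSr fpath_traject.
have h4 : d0 \in L by rewrite memL ed0.
have h5 d : d \in darts tmap -> d \notin L -> step (step (step d)) = d.
  rewrite mem_darts_tmap memL => /triP/and3P[/orP[dL|/andP[/eqP e _]] _ _ dL'].
    by rewrite dL in dL'.
  by apply: tval_inj; rewrite !tval_step.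
have h6 (d : T * T) : d \in darts tmap -> d \notin L -> @opp tmap d \notin L ->
    (step d).2 != (step (@opp tmap d)).2.
  rewrite mem_darts_tmap !memL => /triP/and3P[_ /or3P[dL|dL|ne] _ d1 d2].
  - by rewrite dL in d1.
  - by rewrite dL in d2.
  move: ne.
  by apply: contraNneq => e; rewrite -tval_opp -!tval_step; apply/eqP/(congr1 val e).
have h7 (d : T * T) : d \in L -> @opp tmap d \notin L.
  by rewrite !memL => /Lo/and3P[].
have h8 (d : T * T) : d \in L -> @opp tmap (step (@opp tmap d)) \notin L /\
    @opp tmap (step (step (@opp tmap d))) \notin L.
  by rewrite !memL !(tval_opp, tval_step) => /Lo/and3P[].
have h9 (d : T * T) : d \in darts tmap -> tside (tval (@opp tmap d)) = tside (tval d).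
  by rewrite mem_darts_tmap => /triP/and3P[_ _ /eqP].
have h10 (d : T * T) : d \in darts tmap -> d \notin L -> tside (tval (step d)) = tside (tval d).
  rewrite mem_darts_tmap memL => /triP/and3P[/orP[dL|/andP[_ /eqP e]] _ _ dL'].
    by rewrite dL in dL'.
  by rewrite tval_step.
rewrite -mem_darts_tmap in dAG; rewrite -memL in dAL.
rewrite -mem_darts_tmap in dBG; rewrite -memL in dBL.
have [f1 f2 f3] := @one_big_face tmap L (tside \o tval) d0 dA dB
  h1 h2 h3 h4 h5 h6 h7 h8 h9 h10 dAG dAL sA dBG dBL sB.
exists tmap; split=> //; first exact: tadj_k_connected.
by case: f1 => F FG [cF FF]; exists F => //; rewrite cF size_traject.
Qed.
End Tables.

(* [map1] is a pair of tetrahedra with a common vertex, and the graph of [map5]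
   is K_7 minus an edge; [map6] and [map7] were found by computer search. *)
Definition map1 := [:: [:: 1;3;2;4;6;5]; [:: 0;2;3]; [:: 0;3;1]; [:: 0;1;2];
  [:: 0;5;6]; [:: 0;6;4]; [:: 0;4;5]].
Definition map3 := [:: [:: 1;3;2;4;7;6]; [:: 0;5;7;4;2;3]; [:: 0;3;1;6;7;5];
  [:: 0;1;2]; [:: 0;1;7]; [:: 1;2;7]; [:: 0;7;2]; [:: 0;4;1;5;2;6]].
Definition map5 := [:: [:: 1;5;4;2;6;3]; [:: 0;3;6;4;2;5]; [:: 0;3;5;1;4;6];
  [:: 0;6;1;4;5;2]; [:: 0;5;3;1;6;2]; [:: 0;1;2;3;4]; [:: 0;2;4;1;3]].
Definition map6 := [:: [:: 1;6;5;2;7;8;4]; [:: 0;5;9;8;3;2;6]; [:: 0;3;6;1;4;9;7];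
  [:: 1;8;7;5;4;6;2]; [:: 0;8;9;2;5;6;3]; [:: 0;6;4;3;7;9;1]; [:: 0;1;2;3;4;5];
  [:: 0;2;9;5;3;8]; [:: 0;7;3;1;9;4]; [:: 1;5;7;2;4;8]].
Definition map7 := [:: [:: 1;7;6;2;8;10;3;9;5]; [:: 0;3;10;4;9;8;6;2;7];
  [:: 0;3;7;1;4;10;5;9;6;8]; [:: 0;10;1;4;7;2;5;8;9]; [:: 1;10;2;5;7;3;6;9];
  [:: 0;9;2;10;8;3;6;7;4]; [:: 0;7;5;1;8;2;9;4]; [:: 0;1;2;3;4;5;6];
  [:: 0;2;6;1;9;3;5;10]; [:: 0;3;8;1;4;6;2;5]; [:: 0;8;5;2;4;1;3]].

(** The arguments after the table are the connectivity, the size of the large face, the apex of the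
    cone, a dart of the large face and the hubs. *)
Lemma map1_ok : table_ok map1 1 6 3 (0, 1) [:: 0].
Proof. by []. Qed.
Lemma map3_ok : table_ok map3 3 9 3 (0, 1) [:: 0; 1; 2; 7].
Proof. by []. Qed.
Lemma map5_ok : table_ok map5 5 10 5 (0, 1) [:: 0; 1; 2; 3; 4].
Proof. by []. Qed.
Lemma map6_ok : table_ok map6 6 12 6 (0, 1) [:: 0; 1; 2; 3; 4; 5; 7; 8; 9].
Proof. by []. Qed.
Lemma map7_ok : table_ok map7 7 14 7 (0, 1) [:: 0; 1; 2; 3; 4; 5; 6; 8; 9].
Proof. by []. Qed.

Lemma one_big_face_map_leq c c' f :
  c <= c' -> one_big_face_map c' f -> one_big_face_map c f.
Proof.
by move=> cc' [G [con ? ? ?]]; exists G; split=> //; apply: k_connected_leq con.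
Qed.

Lemma one_big_face_map_lt8 c : 0 < c < 8 -> one_big_face_map c (min1f c).
Proof.
have weaken := one_big_face_map_leq.
case: c => [|[|[|[|[|[|[|[|c]]]]]]]] //= _.
- exact: table_one_big_face_map map1_ok.
- exact: (weaken 2 3 9 isT (table_one_big_face_map map3_ok)).
- exact: table_one_big_face_map map3_ok.
- exact: (weaken 4 5 10 isT (table_one_big_face_map map5_ok)).
- exact: table_one_big_face_map map5_ok.
- exact: table_one_big_face_map map6_ok.
- exact: table_one_big_face_map map7_ok.
Qed.

(** * A family of highly connected maps *)

Section Family.
Variable m : nat.
Local Notation I := 'I_m.+4.+3.
Local Notation V := (I + (I + I))%type.
Local Notation va i := (inl i : V).
Local Notation vb j := (inr (inl j) : V).
Local Notation vc k := (inr (inr k) : V).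
Implicit Types (i j k : I) (x y v : V).

(* The vertices are a_i, b_j, c_k for i, j, k in Z/n.  Start from the embedding
   of K_{n,n,n} with the triangles (a_i, b_j, c_{i-j-1}) and (b_j, a_i, c_{i-j}).
   For j = 0, 2, 4 flip the edge b_j c_0, which gives the edge a_j a_{j+1} and the
   triangle (a_j, c_0, a_{j+1}).  Glue the annulus into these three triangles, and
   merge them into one face by letting a_1, a_3, a_5 trade places around c_0. *)
Definition lo i := (val i \in [:: 0; 2; 4]).
Definition hi i := (val i \in [:: 1; 3; 5]).
(* Row i lists the neighbours of a_i among a_0, ..., a_5 in their cyclic order. *)
Definition band : seq (seq nat) :=
  [:: [:: 1;4;3;5;2]; [:: 3;4;2;5;0]; [:: 3;0;5;1;4];
      [:: 5;0;4;1;2]; [:: 5;2;1;3;0]; [:: 1;2;0;3;4]].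
(** All fifteen pairs occur: the three flipped edges a_0a_1, a_2a_3, a_4a_5 and the twelve edges of
    the octahedron, whose antipodes are exactly these pairs. *)
Definition six i j := [&& val i < 6, val j < 6 & val i != val j].

Definition kadj : rel V := fun x y => match x, y with
  | inl i, inl j => six i j
  | inl _, inr _ | inr _, inl _ => true
  | inr (inl j), inr (inr k) | inr (inr k), inr (inl j) => ~~ ((k == 0%R) && lo j)
  | _, _ => false
  end.

(** In the regular cases this is the third vertex of the triangle on the dart from [x] to [v].
    Around a_i with [hi i] the row of [band] is inserted between c_0 and b_{i-1}, with [lo i]
    between b_i and c_0. *)
Definition krot v x : V := match v, x with
  | inl i, inl j =>
      if six i j then
        let l := nth [::] band i in let p := (index (val j) l).+1 in
        if p < 5 then va (inZp (nth 0 l p))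
        else if hi i then vb (inZp i.-1) else vc 0%R
      else va j
  | inl i, inr (inl j) => if (i == j) && lo j then va (j + 1)%R else vc (i - j)%R
  | inl i, inr (inr k) =>
      if (k == 0%R) && hi i then va (inZp (head 0 (nth [::] band i))) else vb (i - k - 1)%R
  | inr (inl j), inl i => if (i == j + 1)%R && lo j then va j else vc (i - j - 1)%R
  | inr (inl j), inr (inr k) => if (k == 0%R) && lo j then vc k else va (k + j)%R
  | inr (inr k), inl i =>
      if (k == 0%R) && lo i then va (inZp (nth 0 [:: 3; 0; 5; 0; 1] i)) else vb (i - k)%R
  | inr (inr k), inr (inl j) => if (k == 0%R) && lo j then vb j else va (k + j + 1)%R
  | _, _ => x
  end.

Lemma inZpE i : i = inZp i.
Proof. by apply: val_inj; rewrite /= modn_small. Qed.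

Lemma lo_ex i : lo i -> [\/ i = inZp 0, i = inZp 2 | i = inZp 4].
Proof.
by rewrite /lo (inZpE i) !inE /= modn_small // => /or3P[] /eqP ->;
  [constructor 1 | constructor 2 | constructor 3].
Qed.

Lemma hi_ex i : hi i -> [\/ i = inZp 1, i = inZp 3 | i = inZp 5].
Proof.
by rewrite /hi (inZpE i) !inE /= modn_small // => /or3P[] /eqP ->;
  [constructor 1 | constructor 2 | constructor 3].
Qed.

Lemma lt6_ex i : val i < 6 -> exists2 n, n \in iota 0 6 & i = inZp n.
Proof. by move=> i6; exists (val i); [rewrite mem_iota | apply: inZpE]. Qed.

Lemma hi_lo j : hi (j + 1)%R = lo j.
Proof.
apply/idP/idP => [/hi_ex|/lo_ex[] -> //].
have e n : (inZp n.+1 : I) = (inZp n + 1)%R.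
  by apply: val_inj; rewrite /= modnDm addn1.
by case; rewrite e => /addIr ->.
Qed.

Lemma kadj_sym : symmetric kadj.
Proof.
move=> [i|[j|k]] [i'|[j'|k']] //=; rewrite /six; case: (_ < 6) (_ < 6) => [] [] //=.
by rewrite eq_sym.
Qed.

Lemma kadj_irr : irreflexive kadj.
Proof. by move=> [i|[j|k]] //=; rewrite /six eqxx !andbF. Qed.

Lemma krot_out v x : ~~ kadj v x -> krot v x = x.
Proof.
case: v x => [i|[j|k]] [i'|[j'|k']] //=; rewrite ?negbK; first by move/negbTE->.
  by move=> ->.
by move=> ->.
Qed.

Lemma subr1_eq0 i j : (i - j - 1 == 0)%R = (i == j + 1)%R.
Proof. by rewrite subr_eq0 subr_eq addrC. Qed.

Lemma krot_ab i j : ~~ ((i == j) && lo j) -> krot (va i) (vb j) = vc (i - j)%R.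
Proof. by move=> /= /negbTE ->. Qed.

Lemma krot_ac i k : ~~ ((k == 0%R) && hi i) -> krot (va i) (vc k) = vb (i - k - 1)%R.
Proof. by move=> /= /negbTE ->. Qed.

Lemma krot_ba i j : ~~ ((i == j + 1)%R && lo j) -> krot (vb j) (va i) = vc (i - j - 1)%R.
Proof. by move=> /= /negbTE ->. Qed.

Lemma krot_bc j k : ~~ ((k == 0%R) && lo j) -> krot (vb j) (vc k) = va (k + j)%R.
Proof. by move=> /= /negbTE ->. Qed.

Lemma krot_ca k i : ~~ ((k == 0%R) && lo i) -> krot (vc k) (va i) = vb (i - k)%R.
Proof. by move=> /= /negbTE ->. Qed.

Lemma krot_cb k j : ~~ ((k == 0%R) && lo j) -> krot (vc k) (vb j) = va (k + j + 1)%R.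
Proof. by move=> /= /negbTE ->. Qed.

Lemma krot_adj v x : kadj v x -> kadj v (krot v x).
Proof.
case: v x => [i|[j|k]] [i'|[j'|k']].
- move=> /and3P[/lt6_ex[n nn ->] /lt6_ex[n' nn' ->]].
  by move: nn nn'; rewrite !inE => /or4P[/eqP->|/eqP->|/eqP->|/or3P[]/eqP->]
     /or4P[/eqP->|/eqP->|/eqP->|/or3P[]/eqP->].
- move=> _; have [/andP[/eqP-> /lo_ex[] ->] //|ab] := boolP ((i == j') && lo j').
  by rewrite krot_ab.
- move=> _; have [/andP[/eqP-> /hi_ex[] ->] //|ac] := boolP ((k' == 0%R) && hi i).
  by rewrite krot_ac.
- move=> _; have [/andP[/eqP-> lj]|ba] := boolP ((i' == j + 1)%R && lo j).
    by rewrite /= eqxx lj.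
  by rewrite krot_ba //= subr1_eq0.
- by [].
- by move=> /krot_bc ->.
- move=> _; have [/andP[/eqP-> /lo_ex[] ->] //|ca] := boolP ((k == 0%R) && lo i').
  rewrite krot_ca //=; apply: contraNN ca => /andP[/eqP-> ].
  by rewrite subr0 eqxx.
- by move=> /krot_cb ->.
- by [].
Qed.

Lemma nat_I i : exists t : nat, i = (t%:R)%R.
Proof. by exists (val i); rewrite natr_Zp. Qed.

Lemma inZp_nat n : (inZp n : I) = (n%:R)%R.
Proof.
elim: n => [|n IH]; first by apply: val_inj.
by rewrite -natr1 -IH; apply: val_inj; rewrite /= modnDm addn1.
Qed.

Local Notation "u ~~>[ v ] w" := (fconnect (krot v) u w) (at level 70).

Lemma krot_step v x y : krot v x = y -> x ~~>[v] y.
Proof. by move=> <-; apply: fconnect1. Qed.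

Lemma krot_iter v x n : x ~~>[v] iter n (krot v) x.
Proof. exact: fconnect_iter. Qed.

(** The rotation runs c_k, b_{i-k-1}, c_{k+1}, and so on, with the five neighbours among a_0, ...,
    a_5 inserted once. *)
Lemma reach_a i x : kadj (va i) x -> vc 0%R ~~>[va i] x.
Proof.
have c_b k : vc 0%R ~~>[va i] vc k -> vc 0%R ~~>[va i] vb (i - k - 1)%R.
  move=> ck; have [/andP[/eqP k0 hi_i]|n] := boolP ((k == 0%R) && hi i); last first.
    exact: connect_trans ck (krot_step (krot_ac n)).
  (* Five steps pass through the inserted row, the sixth leaves it. *)
  suff -> : vb (i - k - 1)%R = iter 6 (krot (va i)) (vc 0%R) by apply: krot_iter.
  rewrite {}k0 {k ck} subr0; case/hi_ex: hi_i => ->; congr (inr (inl _));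
    by apply: (@addIr _ 1%R); rewrite subrK; apply: val_inj.
have b_c k : vc 0%R ~~>[va i] vb (i - k - 1)%R -> vc 0%R ~~>[va i] vc (k + 1)%R.
  move=> ck; have [/andP[/eqP e _]|n] := boolP ((i == i - k - 1)%R && lo (i - k - 1)%R).
    have -> : (k + 1 = 0)%R.
      have : (k + 1 = i - (i - k - 1))%R by ring.
      by rewrite -e subrr.
    exact: connect0.
  apply: connect_trans ck (krot_step _); rewrite (krot_ab n); congr (inr (inr _)).
  by ring.
have all_c k : vc 0%R ~~>[va i] vc k.
  have [t ->] := nat_I k; elim: t => [|t IH]; first exact: connect0.
  by rewrite -natr1; apply/b_c/c_b.
have all_b j : vc 0%R ~~>[va i] vb j.
  have -> : (j = i - (i - j - 1) - 1)%R by ring.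
  exact/c_b/all_c.
case: x => [i'|[j|k]] //= ii'.
have : va i' \in traject (krot (va i)) (if hi i then vc 0%R else vb i) 6.
  case/and3P: ii' => /lt6_ex[n nn ->] /lt6_ex[n' nn' ->].
  by move: nn nn'; rewrite !inE => /or4P[/eqP->|/eqP->|/eqP->|/or3P[]/eqP->]
     /or4P[/eqP->|/eqP->|/eqP->|/or3P[]/eqP->].
case/trajectP=> n _ ->; case: ifP => _; first exact: krot_iter.
exact: connect_trans (all_b i) (krot_iter _ _ _).
Qed.

Lemma last_a i : exists2 y, kadj (va i) y & krot (va i) y = vc 0%R.
Proof.
have [lo_i|n] := boolP (lo i).
  exists (va (inZp (last 0 (nth [::] band i)))); first by case/lo_ex: lo_i => ->.
  by case/lo_ex: lo_i => ->; apply/eqP.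
by exists (vb i) => //; rewrite krot_ab ?subrr // eqxx.
Qed.

(** The rotation runs a_i, c_{i-j-1}, a_{i-1}, and so on, from a_j down to a_{j+1}; for [lo j] it
    then skips c_0. *)
Lemma reach_b j x : kadj (vb j) x -> va j ~~>[vb j] x.
Proof.
have a_c i : va j ~~>[vb j] va i -> i != (j + 1)%R -> va j ~~>[vb j] vc (i - j - 1)%R.
  move=> ai ne; apply: connect_trans ai (krot_step _).
  by rewrite krot_ba // (negbTE ne).
have a_a i : va j ~~>[vb j] va i -> va j ~~>[vb j] va (i - 1)%R.
  move=> ai; have [->|ne] := eqVneq i (j + 1)%R; first by rewrite addrK; apply: connect0.
  apply: connect_trans (a_c _ ai ne) (krot_step _).
  by rewrite krot_bc ?subr1_eq0 ?(negbTE ne) //; congr (inl _); ring.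
have all_a i : va j ~~>[vb j] va i.
  have -> : (i = j - (j - i))%R by ring.
  have [t ->] := nat_I (j - i)%R; elim: t => [|t IH]; first by rewrite subr0; apply: connect0.
  by rewrite -natr1 opprD addrA; apply: a_a.
case: x => [i|[j'|k]] //= jk.
have [k0|k0] := eqVneq k 0%R; last first.
  have -> : (k = (k + j + 1) - j - 1)%R by ring.
  by apply: a_c => //; rewrite (inj_eq (addIr _)) -subr_eq0 addrK.
rewrite k0 eqxx /= in jk; rewrite k0.
have := @krot_step (vb j) (va (j + 1)%R) (vc 0%R); rewrite krot_ba; last by rewrite (negbTE jk) andbF.
move=> h; apply: connect_trans (all_a (j + 1)%R) (h _); congr (inr (inr _)); ring.
Qed.

Lemma last_b j : exists2 y, kadj (vb j) y & krot (vb j) y = va j.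
Proof.
have [lo_j|n] := boolP (lo j).
  by exists (va (j + 1)%R) => //=; rewrite eqxx lo_j.
by exists (vc 0%R); rewrite ?krot_bc ?add0r //= eqxx.
Qed.

Lemma lo_small n : n < m.+4.+3 -> lo (inZp n) = (n \in [:: 0; 2; 4]).
Proof. by move=> nm; rewrite /lo /= modn_small. Qed.

(** The rotation runs a_i, b_{i-k}, a_{i+1}, and so on. Around c_0 the flips and the trade make it
    visit the a-vertices in the order 0, 3, 4, 1, 2, 5, 6 and upwards. *)
Lemma reach_c k x : kadj (vc k) x -> va 0%R ~~>[vc k] x.
Proof.
have a_b i : va 0%R ~~>[vc k] va i -> ~~ ((k == 0%R) && lo i) -> va 0%R ~~>[vc k] vb (i - k)%R.
  by move=> ai n; apply: connect_trans ai (krot_step (krot_ca n)).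
have a_a i : va 0%R ~~>[vc k] va i -> ~~ ((k == 0%R) && lo i) -> va 0%R ~~>[vc k] va (i + 1)%R.
  move=> ai n; apply: connect_trans (a_b _ ai n) (krot_step _).
  rewrite krot_cb; first by congr (inl _); ring.
  by apply: contraNN n => /andP[/eqP->]; rewrite subr0 eqxx.
have all_a i : va 0%R ~~>[vc k] va i.
  have [k0|k0] := eqVneq k 0%R; last first.
    have [t ->] := nat_I i; elim: t => [|t IH]; first exact: connect0.
    by rewrite -natr1; apply: a_a; rewrite // (negbTE k0).
  have a_s t : va 0%R ~~>[vc k] va (inZp t) -> ~~ lo (inZp t) ->
      va 0%R ~~>[vc k] va (inZp t.+1).
    by move=> at_ n; rewrite inZp_nat -natr1 -inZp_nat; apply: a_a; rewrite // negb_and n orbT.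
  have jump t t' : va 0%R ~~>[vc k] va (inZp t) -> krot (vc k) (va (inZp t)) = va (inZp t') ->
      va 0%R ~~>[vc k] va (inZp t').
    by move=> at_ e; apply: connect_trans at_ (krot_step e).
  have a0 : va 0%R ~~>[vc k] va (inZp 0).
    by have -> : (inZp 0 : I) = 0%R; [apply: val_inj | apply: connect0].
  have a3 : va 0%R ~~>[vc k] va (inZp 3) by apply: jump a0 _; rewrite k0.
  have a4 : va 0%R ~~>[vc k] va (inZp 4) by apply: a_s a3 _.
  have a1 : va 0%R ~~>[vc k] va (inZp 1) by apply: jump a4 _; rewrite k0.
  have a2 : va 0%R ~~>[vc k] va (inZp 2) by apply: a_s a1 _.
  have a5 : va 0%R ~~>[vc k] va (inZp 5) by apply: jump a2 _; rewrite k0.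
  rewrite (inZpE i); have := ltn_ord i; elim: (nat_of_ord i) => [//|t IH] tm.
  case: t IH tm => [|[|[|[|[|t]]]]] // IH tm; apply: a_s; first exact/IH/ltnW.
  by rewrite lo_small // ltnW.
case: x => [i|[j|k']] //= kj.
have -> : (j = (j + k) - k)%R by ring.
apply: a_b; first exact: all_a.
by apply: contraNN kj => /andP[/eqP->]; rewrite addr0 eqxx.
Qed.

Lemma last_c k : exists2 y, kadj (vc k) y & krot (vc k) y = va 0%R.
Proof.
have nlo : ~~ ((k == 0%R) && lo (- k - 1)%R).
  apply/negP=> /andP[/eqP->]; rewrite oppr0 add0r => /lo_ex e.
  have : (0 = -1 + 1 :> I)%R by rewrite addNr.
  by case: e => -> /eqP.
exists (vb (- k - 1)%R); first by [].
by rewrite krot_cb //; congr (inl _); ring.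
Qed.

Lemma krot_good v : injective (krot v) /\
  (forall x y, kadj v x -> fconnect (krot v) x y = kadj v y).
Proof.
have [x0 [y0 [y0v y0x reach]]] : exists x0 y0, [/\ kadj v y0, krot v y0 = x0
    & forall x, kadj v x -> x0 ~~>[v] x].
  case: v => [i|[j|k]].
  - have [y yv yx] := last_a i; exists (vc 0%R), y; split=> //; exact: reach_a.
  - have [y yv yx] := last_b j; exists (va j), y; split=> //; exact: reach_b.
  - have [y yv yx] := last_c k; exists (va 0%R), y; split=> //; exact: reach_c.
split.
  exact: reach_inj (@krot_adj v) (@krot_out v) y0v y0x reach.
move=> x y; exact: reach_cyc (@krot_adj v) (@krot_out v) y0v y0x reach x y.
Qed.

(** The a_i serve as hubs: any two have all b_j as common neighbours, and every other vertex is
    adjacent to all of them. *)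
Lemma kadj_k_connected : k_connected kadj m.+4.+3 [set: V].
Proof.
have card_im (f : I -> V) (A : {set V}) : injective f -> (forall i, f i \in A) -> m.+4.+3 <= #|A|.
  move=> f_inj fA; rewrite -[X in X <= _]card_ord -(card_imset predT f_inj).
  by apply: subset_leq_card; apply/subsetP=> _ /imsetP[i _ ->].
apply: (hub_k_connected kadj_sym (K := [set va i | i : I])) => //.
- by rewrite !card_sum !card_ord; lia.
- move=> _ _ /imsetP[i _ ->] /imsetP[i' _ ->]; apply/or3P; constructor 3.
  by apply: (card_im (fun j => vb j)) => [j j' []|j] //; rewrite inE.
- move=> v vA; apply: (card_im (fun i => va i)) => [j j' []|j] //.
  rewrite inE imset_f //=; case: v vA => [i|[]] //=.
  by rewrite imset_f.
Qed.

Lemma V_gt0 : 0 < #|{: V}|.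
Proof. by rewrite !card_sum card_ord. Qed.

Definition kmap : emap :=
  emap_of kadj_sym kadj_irr V_gt0 (k_connected_connected (isT : 0 < m.+4.+3) kadj_k_connected)
    (fun v => (krot_good v).1) krot_out (fun v x y => (krot_good v).2 x y).

Definition kstep (d : V * V) : V * V := (d.2, krot d.2 d.1).

(** The fifteen darts are the nine of the triangles (a_j, c_0, a_{j+1}) for j = 0, 2, 4 and three on
    each boundary triangle of the annulus, a_0a_2a_4 and a_1a_3a_5. *)
Definition kbig : seq (V * V) :=
  let a n := va (inZp n) in let c := vc 0%R in
  [:: (a 0, c); (c, a 3); (a 3, a 5); (a 5, a 4); (a 4, a 2);
      (a 2, c); (c, a 5); (a 5, a 1); (a 1, a 0); (a 0, a 4);
      (a 4, c); (c, a 1); (a 1, a 3); (a 3, a 2); (a 2, a 0)].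

(** Selects the edges of the glued octahedron: two of its vertices are antipodal when their indices
    have the same half. *)
Definition kside (d : V * V) : bool :=
  match d with (inl i, inl j) => six i j && ((val i)./2 != (val j)./2) | _ => false end.

Let kopp : V * V -> V * V := @opp kmap.

(** One of the two classes of triangles of the Cayley table, [black] being the other; the excluded
    ones contain a flipped edge b_jc_0. *)
Lemma white i j : ~~ ((i == j) && lo j) ->
  [/\ kstep (vb j, va i) = (va i, vc (i - j)%R),
      kstep (va i, vc (i - j)%R) = (vc (i - j)%R, vb j) &
      kstep (vc (i - j)%R, vb j) = (vb j, va i)].
Proof.
move=> n; have n' : ~~ ((i - j == 0)%R && lo j) by rewrite subr_eq0.
rewrite /kstep krot_ab // krot_ca; last first.
  by apply: contraNN n; rewrite subr_eq0 => /andP[/eqP->]; rewrite eqxx.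
rewrite krot_bc //; split=> //; congr (_, _); [congr (inr (inl _))|congr (inl _)]; ring.
Qed.

Lemma black i j : ~~ ((i == j + 1)%R && lo j) ->
  [/\ kstep (va i, vb j) = (vb j, vc (i - j - 1)%R),
      kstep (vb j, vc (i - j - 1)%R) = (vc (i - j - 1)%R, va i) &
      kstep (vc (i - j - 1)%R, va i) = (va i, vb j)].
Proof.
move=> n; have n' : ~~ ((i - j - 1 == 0)%R && lo j) by rewrite subr1_eq0.
rewrite /kstep krot_ba // krot_cb // krot_ac; last first.
  by apply: contraNN n; rewrite subr1_eq0 => /andP[/eqP->]; rewrite hi_lo eqxx.
split=> //; congr (_, _); [congr (inl _)|congr (inr (inl _))]; ring.
Qed.

(** After a change of indices, a regular dart lies on a [white] or [black] triangle; the finitely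
    many darts near the flips and the annulus are evaluated. *)
Lemma kstep3 x y : kadj x y -> (x, y) \notin kbig ->
  kstep (kstep (kstep (x, y))) = (x, y) /\ kside (kstep (x, y)) = kside (x, y).
Proof.
case: x y => [i|[j|k]] [i'|[j'|k']]; [ | | | | by [] | | | | by []].
- move=> /and3P[/lt6_ex[n nn ->] /lt6_ex[n' nn' ->]].
  by move: nn nn'; rewrite !inE => /or4P[/eqP->|/eqP->|/eqP->|/or3P[]/eqP->]
     /or4P[/eqP->|/eqP->|/eqP->|/or3P[]/eqP->] //= _ _; split; apply/eqP.
- move=> _ _; have [/andP[/eqP-> /lo_ex[] ->]|n] := boolP ((i == j' + 1)%R && lo j').
  + by split; apply/eqP.
  + by split; apply/eqP.
  + by split; apply/eqP.
  by have [e1 e2 e3] := black n; rewrite e1 e2 e3.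
- move=> _ nL; have -> : (k' = i - (i - k'))%R by ring.
  have n : ~~ ((i == i - k')%R && lo (i - k')%R).
    apply: contraNN nL => /andP[/eqP e]; rewrite -e.
    have -> : (k' = i - (i - k'))%R by ring.
    by rewrite -e subrr => /lo_ex[] ->.
  by have [e1 e2 e3] := white n; rewrite e2 e3 e1.
- move=> _ _; have [/andP[/eqP-> /lo_ex[] ->]|n] := boolP ((i' == j) && lo j).
  + by split; apply/eqP.
  + by split; apply/eqP.
  + by split; apply/eqP.
  by have [e1 e2 e3] := white n; rewrite e1 e2 e3.
- move=> jk _; have -> : (k' = (k' + j + 1) - j - 1)%R by ring.
  have n : ~~ (((k' + j + 1) == j + 1)%R && lo j).
    by rewrite (inj_eq (addIr _)) -subr_eq0 addrK.
  by have [e1 e2 e3] := black n; rewrite e2 e3 e1.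
- move=> _ nL; have -> : (k = i' - (i' - k - 1) - 1)%R by ring.
  have n : ~~ ((i' == (i' - k - 1) + 1)%R && lo (i' - k - 1)%R).
    apply: contraNN nL => /andP[/eqP e]; rewrite -hi_lo -e.
    have -> : (k = i' - ((i' - k - 1) + 1))%R by ring.
    by rewrite -e subrr => /hi_ex[] ->.
  by have [e1 e2 e3] := black n; rewrite e3 e1 e2.
- move=> jk _; have -> : (k = (k + j') - j')%R by ring.
  have n : ~~ (((k + j') == j')%R && lo j').
    by rewrite -subr_eq0 addrK.
  by have [e1 e2 e3] := white n; rewrite e3 e1 e2.
Qed.

(** The apexes on the two sides of a regular edge belong to the same class and have indices
    differing by one. *)
Lemma kapex x y : kadj x y -> (x, y) \notin kbig -> (y, x) \notin kbig ->
  krot y x != krot x y.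
Proof.
have ne1 i : (i - 1 != i)%R by rewrite -subr_eq0 addrAC subrr add0r oppr_eq0.
have ne2 i : (i + 1 != i)%R by rewrite -subr_eq0 addrAC subrr add0r.
have eqa i i' : (va i == va i') = (i == i') by [].
have eqb j j' : (vb j == vb j') = (j == j') by [].
have eqc k k' : (vc k == vc k') = (k == k') by [].
wlog : x y / match x, y with inl _, _ | inr (inl _), inr (inr _) => true | _, _ => false end.
  move=> h xy nL nL'; have yx : kadj y x by rewrite kadj_sym.
  have [xy' yx'] := (h x y, h y x); move: xy xy' yx' {h}; rewrite (eq_sym (krot x y)).
  by case: x y nL nL' yx => [i|[j|k]] [i'|[j'|k']] nL nL' yx xy h1 h2 //;
    first [exact: h1 | exact: h2].
case: x y => [i|[j|k]] [i'|[j'|k']] // _.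
- move=> /and3P[/lt6_ex[n nn ->] /lt6_ex[n' nn' ->]].
  by move: nn nn'; rewrite !inE => /or4P[/eqP->|/eqP->|/eqP->|/or3P[]/eqP->]
     /or4P[/eqP->|/eqP->|/eqP->|/or3P[]/eqP->].
- move=> _ _ _ /=; case: ifP => _; case: ifP => _ //=.
  + by rewrite eq_sym eqa ne2.
  + by rewrite eqc ne1.
- move=> _ nL nL' /=.
  have -> : (k' == 0%R) && lo i = false.
    by apply: contraNF nL => /andP[/eqP-> /lo_ex[] ->].
  have -> : (k' == 0%R) && hi i = false.
    by apply: contraNF nL' => /andP[/eqP-> /hi_ex[] ->].
  by rewrite eq_sym eqb ne1.
- move=> /= /negbTE-> _ _.
  by rewrite eqa ne2.
Qed.

Lemma kmap_one_big_face : one_big_face_map m.+4.+3 15.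
Proof.
have stepE d : @face_step kmap d = kstep d by rewrite face_step_of.
have dartE (d : V * V) : (d \in darts kmap) = kadj d.1 d.2 by rewrite inE.
pose d0 : V * V := (va (inZp 0), vc 0%R).
pose dA : V * V := (va (inZp 1), va (inZp 4)).
pose dB : V * V := (va (inZp 0), vb 0%R).
have h1 : {subset kbig <= darts kmap}.
  move=> d; rewrite dartE => dL; apply: (allP _ d dL : (fun d : V * V => kadj d.1 d.2) d).
  by [].
have h2 : uniq kbig by [].
have h3 : fcycle (@face_step kmap) kbig.
  rewrite (eq_cycle (e' := frel kstep)); first by [].
  by move=> x y /=; rewrite stepE.
have h5 (d : V * V) : d \in darts kmap -> d \notin kbig ->
    @face_step kmap (@face_step kmap (@face_step kmap d)) = d.
  by rewrite dartE !stepE; case: d => x y xy nL; have [] := kstep3 xy nL.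
have h6 (d : V * V) : d \in darts kmap -> d \notin kbig -> kopp d \notin kbig ->
    (@face_step kmap d).2 != (@face_step kmap (kopp d)).2.
  by rewrite dartE !stepE; case: d => x y; apply: kapex.
have h7 (d : V * V) : d \in kbig -> kopp d \notin kbig.
  by move: d; apply/allP.
have h8 (d : V * V) : d \in kbig -> kopp (@face_step kmap (kopp d)) \notin kbig /\
    kopp (@face_step kmap (@face_step kmap (kopp d))) \notin kbig.
  (* The large face contains no b_j, whereas the triangle across one of its darts at c_0 has its
     apex among the b_j. *)
  have noB x j : (x, vb j) \notin kbig /\ (vb j, x) \notin kbig.
    by rewrite !inE !xpair_eqE !andbF.
  have : all (fun d => match d with
      | (inl i, inr (inr k)) => (k == 0%R) && lo i
      | (inr (inr k), inl i) => (k == 0%R) && hi i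
      | (inl i, inl i') => (kopp (kstep (kopp d)) \notin kbig)
                        && (kopp (kstep (kstep (kopp d))) \notin kbig)
      | _ => false end) kbig by [].
  rewrite !stepE => /allP h /h {h}; case: d => [[i|[j|k]] [i'|[j'|k']]] //.
  - by case/andP.
  - move=> /andP[/eqP-> lo_i]; have n : ~~ ((0%R == 0%R :> I) && hi i).
      by case/lo_ex: lo_i => ->.
    by rewrite /kstep /kopp /opp !(krot_ac n); split; [exact: (noB _ _).2 | exact: (noB _ _).1].
  - move=> /andP[/eqP-> hi_i]; have n : ~~ ((0%R == 0%R :> I) && lo i').
      by case/hi_ex: hi_i => ->.
    by rewrite /kstep /kopp /opp !(krot_ca n); split; [exact: (noB _ _).2 | exact: (noB _ _).1].
have h9 (d : V * V) : d \in darts kmap -> kside (kopp d) = kside d.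
  rewrite dartE; case: d => [[i|[j|k]] [i'|[j'|k']]] //= _; rewrite /six !(eq_sym (val i')).
  by rewrite [_ == (val i)./2]eq_sym andbCA.
have h10 (d : V * V) : d \in darts kmap -> d \notin kbig ->
    kside (@face_step kmap d) = kside d.
  by rewrite dartE stepE; case: d => x y xy nL; have [] := kstep3 xy nL.
have hA : dA \in darts kmap by rewrite dartE.
have hB : dB \in darts kmap by rewrite dartE.
exists kmap.
have [f1 f2 f3] := @one_big_face kmap kbig kside d0 dA dB
  h1 h2 h3 isT h5 h6 h7 h8 h9 h10 hA isT isT hB isT isT.
split=> //; exact: kadj_k_connected.
Qed.
End Family.

Theorem theorem2 (c : nat) (c_ge1 : 1 <= c) :
  (exists G : emap,
     [/\ k_connected (@adj G) c [set: vertex G],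
         exists2 F, F \in faces G &
           #|F| = min1f c /\
             (forall F', F' \in faces G -> F' != F -> #|F'| = 3),
         simple_dual G
       & has_1cut (@dual_adj G) (faces G)])
  /\
  (forall G : emap,
     k_connected (@adj G) c [set: vertex G] ->
     simple_dual G ->
     (forall F, F \in faces G -> #|F| < min1f c) ->
     k_connected (@dual_adj G) 2 (faces G)).
Proof.
split; last by move=> G con; apply: dual_2connected c_ge1 con.
have [c8|c8] := ltnP c 8; first by apply: one_big_face_map_lt8; rewrite c_ge1.
have -> : min1f c = 15 by case: c c8 {c_ge1} => [|[|[|[|[|[|[|[|c]]]]]]]].
(* The member of the family with [m = c] is even (c + 7)-connected. *)
apply: one_big_face_map_leq (kmap_one_big_face c).
by lia.
Qed.
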